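(* Let $d\in\mathbb{N}$, let $g:\mathbb{R}\to\mathbb{R}$ be real analytic and let $f:\mathbb{T}^d\to\mathbb{R}$ be a real trigonometric polynomial with average $f_0$. Assume that there is $c_0\in\mathbb{R}$ such that $g(c_0)=f_0$ and $g'(c_0)>0$. Then for any $\omega\in\mathbb{R}^d$ with $\omega\cdot\nu\neq0$ for all $\nu\in\mathbb{Z}^d\setminus\{0\}$, for all $\varepsilon>0$ small enough, the equation $$\varepsilon\,\ddot x+\dot x+\varepsilon\,g(x)=\varepsilon\,f(\omega t)$$ has a quasi-periodic solution with frequency vector $\omega$ which is a local attractor.
   Context: $\mathbb{T}^d=(\mathbb{R}/2\pi\mathbb{Z})^d$. A quasi-periodic solution with frequency vector $\omega$ is a solution of the form $x_0(t)=U(\omega t)$ with $U:\mathbb{T}^d\to\mathbb{R}$ continuous. A solution $x_0(t)$ is a local attractor if there is a simply connected open set (in the phase space $\mathbb{R}^2$ of the variables $(x,\dot x)$) containing the solution, i.e. containing $(x_0(t),\dot x_0(t))$ for all $t$, such that all trajectories starting (at time $0$) inside that set tend to the solution as time goes to infinity, i.e. $|x(t)-x_0(t)|+|\dot x(t)-\dot x_0(t)|\to0$ as $t\to+\infty$. *)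

(* Defs.v *)
From HB Require Import structures.
From mathcomp Require Export all_boot all_order all_algebra.
From mathcomp Require Export all_classical all_reals all_analysis.

Set Implicit Arguments.
Unset Strict Implicit.
Unset Printing Implicit Defensive.

Import Order.TTheory GRing.Theory Num.Theory.
Import numFieldTopology.Exports numFieldNormedType.Exports.

Local Open Scope ring_scope.
Local Open Scope classical_set_scope.

(* Functions on the torus (R / 2 pi Z)^d are represented by their lifts to R^d,
   i.e. by functions on R^d that are 2 pi-periodic in each coordinate; the
   function on the torus is continuous iff its lift is. *)
Definition torus_fun (R : realType) (d : nat) (F : 'rV[R]_d -> R) : Prop :=
  forall i : 'I_d, periodic F ((pi *+ 2) *: delta_mx 0 i).

Definition int_dot (R : realType) (d : nat) (nu : 'rV[int]_d) (v : 'rV[R]_d) :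
    R :=
  \sum_(i < d) (nu 0 i)%:~R * v 0 i.

Definition trig_polynomial (R : realType) (d : nat) (F : 'rV[R]_d -> R) :
    Prop :=
  exists (s : seq 'rV[int]_d) (a b : 'rV[int]_d -> R), forall psi,
    F psi = \sum_(nu <- s)
      (a nu * cos (int_dot nu psi) + b nu * sin (int_dot nu psi)).

(* Integral over [0, 2 pi]^d, written as an iterated integral. *)
Fixpoint torus_integral (R : realType) (d : nat) :
    ('rV[R]_d -> R) -> R :=
  match d with
  | 0 => fun F => F 0
  | n.+1 => fun F =>
      \int[@lebesgue_measure R]_(u in `[0, pi *+ 2])
        torus_integral (fun v : 'rV[R]_n =>
          F (row_mx (const_mx u : 'rV[R]_1) v))
  end.

Definition torus_average (R : realType) (d : nat) (F : 'rV[R]_d -> R) : R :=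
  torus_integral F / (pi *+ 2) ^+ d.

Definition real_analytic (R : realType) (g : R -> R) : Prop :=
  forall a : R, exists (c : R^nat) (r : R), 0 < r /\
    forall x, `|x - a| < r -> pseries c (x - a) @ \oo --> g x.

(* [x] solves eps x'' + x' + eps g(x) = eps h(t) at every t in [I]; only used
   with [I] open, so that all derivatives are two-sided. *)
Definition solves (R : realType) (eps : R) (g h : R -> R) (I : set R)
    (x : R -> R) : Prop :=
  forall t, I t ->
    [/\ derivable x t 1,
        derivable x^`() t 1 &
        eps * x^`(2)%classic t + x^`()%classic t + eps * g (x t) = eps * h t].

Definition path_in (R : realType) (T : topologicalType) (A : set T)
    (gamma : R -> T) : Prop :=
  {within `[0, 1], continuous gamma} /\ gamma @` `[0, 1] `<=` A.

Definition path_connected (R : realType) (T : topologicalType) (A : set T) :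
    Prop :=
  forall p q, A p -> A q ->
    exists gamma : R -> T, [/\ path_in A gamma, gamma 0 = p & gamma 1 = q].

(* Homotopy in [A], with fixed base point, from the loop [gamma] to the
   constant loop; [H (s, .)] is the loop at stage [s]. *)
Definition null_homotopic (R : realType) (T : topologicalType) (A : set T)
    (gamma : R -> T) : Prop :=
  exists H : R * R -> T,
    [/\ {within `[0, 1] `*` `[0, 1], continuous H},
        H @` (`[0, 1] `*` `[0, 1]) `<=` A,
        forall t : R, t \in `[0, 1] ->
          H (0, t) = gamma t /\ H (1, t) = gamma 0 &
        forall s : R, s \in `[0, 1] ->
          H (s, 0) = gamma 0 /\ H (s, 1) = gamma 0].

Definition simply_connected (R : realType) (T : topologicalType) (A : set T) :
    Prop :=
  [/\ A !=set0, path_connected R A &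
      forall gamma : R -> T, path_in A gamma -> gamma 0 = gamma 1 ->
        null_homotopic A gamma].

(* A trajectory starting at [p] at time 0 and defined for all future times; its
   domain extends slightly to the left of 0 so that x'(0) makes sense. *)
Definition trajectory_from (R : realType) (eps : R) (g h : R -> R) (p : R * R)
    (x : R -> R) : Prop :=
  (exists2 delta : R, 0 < delta & solves eps g h `]- delta, +oo[ x) /\
  (x 0, x^`() 0) = p.

Definition tends_to (R : realType) (x x0 : R -> R) : Prop :=
  `|x t - x0 t| + `|x^`()%classic t - x0^`()%classic t| @[t --> +oo] --> 0.

(* Trajectories starting in [O] must not blow up in finite time: this is the
   existence clause. As g is locally Lipschitz in the intended use, solutions
   are unique, so the two clauses together cover every trajectory. *)
Definition local_attractor (R : realType) (eps : R) (g h : R -> R)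
    (x0 : R -> R) : Prop :=
  exists O : set (R * R),
    [/\ open O,
        simply_connected R O,
        forall t, O (x0 t, x0^`() t) &
        forall p, O p ->
          (exists x, trajectory_from eps g h p x) /\
          (forall x, trajectory_from eps g h p x -> tends_to x x0)].

Definition quasi_periodic (R : realType) (d : nat) (omega : 'rV[R]_d)
    (x : R -> R) : Prop :=
  exists U : 'rV[R]_d -> R,
    [/\ torus_fun U, continuous U & forall t, x t = U (t *: omega)].

(* Main.v *)
(* Write [f = f0 + H1] where [f0 = g c0] is the average. As [f] is a trigonometric
   polynomial and [omega] is nonresonant, [H1] is the derivative along [omega]
   of a trigonometric polynomial [H0], so no small divisors appear. With
   [x = c0 + eps H0(omega t) + w] and [a = g'(c0)], the equation becomes
   [w'' + w' / eps + a w = q], where [q] is of order [eps] up to the nonlinear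
   remainder [g (c0 + y) - g c0 - a y] at [y = eps H0 + w], whose Lipschitz
   constant is at most [a / 2] for [|y| <= rho]. For small [eps] the linear part
   factors as [(D + mu1) (D + mu2)] with [mu1, mu2 > 0] and [mu1 mu2 = a], i.e.
   [w' = - mu2 w + V], [V' = - mu1 V + q]. The bounded right inverse of each
   factor has sup norm [1 / mu_i], so with the remainder truncated outside
   [[- rho, rho]] both the bounded solution on the whole line and the initial
   value problem are fixed points of a contraction with constant [1 / 2]. The
   bounded solutions for all phases [psi + omega t] depend continuously on
   [psi], uniformly in time, and by uniqueness they are
   [U (psi + omega t)] for one continuous [U] on the torus. Trajectories starting
   in a parallelogram in the phase plane never leave the region where the
   truncation is inactive, and a Lyapunov function for the difference of two
   of them shows that they converge to each other. *)
Require Import Defs.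
From mathcomp Require Import all_boot all_order all_algebra.
From mathcomp Require Import all_classical all_reals all_analysis.
From mathcomp Require Import ring lra.

Set Implicit Arguments.
Unset Strict Implicit.
Unset Printing Implicit Defensive.

Import Order.TTheory GRing.Theory Num.Theory.
Import numFieldTopology.Exports numFieldNormedType.Exports.

Local Open Scope ring_scope.
Local Open Scope classical_set_scope.

(** * Differentiation rules and monotonicity for functions of one real variable *)

Section PointwiseDerivatives.
Context {R : realType}.
Implicit Types (f g : R -> R) (x c df dg : R).

Lemma is_derive_cst1 c x : is_derive x 1 (fun=> c) 0.
Proof. exact: is_derive_cst. Qed.

Lemma is_deriveD1 f g x df dg : is_derive x 1 f df -> is_derive x 1 g dg ->
  is_derive x 1 (fun t => f t + g t) (df + dg).
Proof. by move=> ? ?; exact: is_deriveD. Qed.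

Lemma is_deriveB1 f g x df dg : is_derive x 1 f df -> is_derive x 1 g dg ->
  is_derive x 1 (fun t => f t - g t) (df - dg).
Proof. by move=> ? ?; exact: is_deriveB. Qed.

Lemma is_deriveN1 f x df : is_derive x 1 f df ->
  is_derive x 1 (fun t => - f t) (- df).
Proof. by move=> ?; exact: is_deriveN. Qed.

Lemma is_deriveM1 f g x df dg : is_derive x 1 f df -> is_derive x 1 g dg ->
  is_derive x 1 (fun t => f t * g t) (df * g x + f x * dg).
Proof.
move=> fx gx; have := is_deriveM fx gx => fgx; apply: is_derive_eq.
by rewrite /GRing.scale/= addrC mulrC.
Qed.

Lemma is_deriveZ1 c f x df : is_derive x 1 f df ->
  is_derive x 1 (fun t => c * f t) (c * df).
Proof. by move=> ?; exact: (@is_deriveZ _ _ _ f c). Qed.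

Lemma is_derive_expRM c x :
  is_derive x 1 (fun t => expR (c * t)) (c * expR (c * x)).
Proof.
have cx : is_derive x 1 (fun t => c * t) (c * 1) by exact: is_deriveZ1.
have h := @is_derive1_comp _ expR _ _ _ _ (is_derive_expR (c * x)) cx.
by apply: is_derive_eq; rewrite mulr1 mulrC.
Qed.

Lemma is_derive_continuous f x df : is_derive x 1 f df ->
  {for x, continuous f}.
Proof.
by move=> [dfx _]; apply: differentiable_continuous; exact/derivable1_diffP.
Qed.

Lemma le0_is_derive_le f (df : R -> R) (s t : R) : s <= t ->
  (forall u, s <= u <= t -> is_derive u 1 f (df u)) ->
  (forall u, s <= u <= t -> df u <= 0) -> f t <= f s.
Proof.
move=> st dfE df0.
have [||c cst E] := @MVT_segment R f df s t st.
- by move=> x; rewrite in_itv/= => /andP[sx xt]; apply: dfE; rewrite !ltW.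
- apply: continuous_in_subspaceT => x; rewrite inE/= in_itv/= => xst.
  exact: is_derive_continuous (dfE _ xst).
by rewrite -subr_le0 E mulr_le0_ge0 ?subr_ge0// df0.
Qed.

Lemma ge0_is_derive_le f (df : R -> R) (s t : R) : s <= t ->
  (forall u, s <= u <= t -> is_derive u 1 f (df u)) ->
  (forall u, s <= u <= t -> 0 <= df u) -> f s <= f t.
Proof.
move=> st dfE df0; rewrite -lerN2.
apply: (@le0_is_derive_le (fun u => - f u) (fun u => - df u)) => // u ust.
  by apply: is_deriveN1; exact: dfE.
by rewrite oppr_le0 df0.
Qed.

Lemma eq_is_derive0 f (s t : R) : s <= t ->
  (forall u, s <= u <= t -> is_derive u 1 f 0) -> f s = f t.
Proof.
move=> st f0; apply/eqP; rewrite eq_le.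
by rewrite (ge0_is_derive_le st f0)// (le0_is_derive_le st f0).
Qed.

End PointwiseDerivatives.

(** * Antiderivatives on the whole line *)

Section Antiderivative.
Context {R : realType}.
Notation mu := (@lebesgue_measure R).

(** The integrals from [- n] are antiderivatives on growing half-lines and differ by constants
    there. Normalized to vanish at 0 they agree, so they glue. *)
Lemma exists_antiderivative (p : R -> R) : continuous p ->
  exists P : R -> R, forall t : R, is_derive t 1 P (p t).
Proof.
move=> cp.
pose F (n : nat) (x : R) := \int[mu]_(u in `[- n%:R, x]) p u.
have dF n (x : R) : - n%:R < x -> is_derive x 1 (F n) (p x).
  move=> nx.
  have [||||dFx <-] := @continuous_FTC1_closed R p (- n%:R) x (x + 1).
  - by rewrite ltrDl.
  - exact: (continuous_compact_integrable (@segment_compact _ _ _)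
      (continuous_subspaceT cp)).
  - exact: nx.
  - exact: cp.
  by rewrite derive1E; exact: derivableP.
have FE m n (x : R) : (0 < m)%N -> (0 < n)%N -> - m%:R < x -> - n%:R < x ->
    F m x - F m 0 = F n x - F n 0.
  move=> m0 n0 mx nx.
  have m0' : - m%:R < 0 :> R by rewrite oppr_lt0 ltr0n.
  have n0' : - n%:R < 0 :> R by rewrite oppr_lt0 ltr0n.
  have d0 (u : R) : - m%:R < u -> - n%:R < u ->
      is_derive u 1 (fun v => F m v - F n v) 0.
    by move=> mu' nu'; rewrite -(subrr (p u)); apply: is_deriveB1; exact: dF.
  have : F m x - F n x = F m 0 - F n 0.
    case: (leP x 0) => x0.
      apply: (@eq_is_derive0 _ (fun v => F m v - F n v) x 0) => //.
      move=> u /andP[xu _]; apply: d0.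
        exact: lt_le_trans xu.
      exact: lt_le_trans xu.
    apply/esym/(@eq_is_derive0 _ (fun v => F m v - F n v) 0 x (ltW x0)).
    move=> u /andP[xu _]; apply: d0.
      exact: lt_le_trans xu.
    exact: lt_le_trans xu.
  lra.
pose N (x : R) := (Num.truncn `|x|).+1.
have NP x : - (N x)%:R < x.
  rewrite ltrNl; apply: le_lt_trans (truncnS_gt _).
  by rewrite -normrN ler_norm.
exists (fun x => F (N x) x - F (N x) 0) => t.
(* The index [N y] varies with [y]; near [t] the glued function is compared with the single piece of
   index [M], whose half-line contains a neighbourhood of [t]. *)
pose M := (N t).+1.
apply: (@near_eq_is_derive _ _ _ (fun x => F M x - F M 0)).
  near=> y; apply: FE => //.
  have : - (N t)%:R - 1 < y; last by rewrite /M -natr1 opprD.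
  by near: y; apply: lt_nbhsr; rewrite ltrBlDr (lt_trans (NP t))// ltrDl.
rewrite -[p t]subr0; apply: is_deriveB1.
by apply: dF; apply: lt_trans (NP t); rewrite ltrN2 ltr_nat.
Unshelve. all: by end_near. Qed.

End Antiderivative.

(** * Linear relaxation equations *)

(** Order completeness in the form used below: it supplies the limit at minus infinity of an
    antiderivative and the pointwise limit of Picard iterates. *)
Lemma exists_between {R : realType} (I : Type) (i0 : I) (l u : I -> R) :
  (forall i j, l i <= u j) -> exists x, forall i, l i <= x <= u i.
Proof.
move=> lu; have hS : has_sup (range l).
  by split; [exists (l i0), i0 | exists (u i0) => _ [i _ <-]].
exists (sup (range l)) => i; apply/andP; split.
  by apply: (sup_upper_bound hS); exists i.
by apply: ge_sup; [exact: hS.1 | move=> _ [j _ <-]].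
Qed.

Section Relaxation.
Context {R : realType}.
Implicit Types (V p : R -> R) (mu s t M N : R).

(** Integrating factor: the derivative of [(V - N) * expR (mu * u)] is
    [(p - mu * N) * expR (mu * u)]. *)
Lemma relax_le mu N V p s t : s <= t ->
  (forall u : R, s <= u <= t -> is_derive u 1 V (- mu * V u + p u)) ->
  (forall u, s <= u <= t -> p u <= mu * N) ->
  (V t - N) * expR (mu * t) <= (V s - N) * expR (mu * s).
Proof.
move=> st dV pN.
apply: (@le0_is_derive_le _ (fun u => (V u - N) * expR (mu * u))
  (fun u => (p u - mu * N) * expR (mu * u)) _ _ st) => u ust; last first.
  by rewrite pmulr_lle0 ?expR_gt0// subr_le0 pN.
have h1 := is_deriveB1 (dV u ust) (is_derive_cst1 N u).
have h2 := is_deriveM1 h1 (is_derive_expRM mu u).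
by apply: is_derive_eq; ring.
Qed.

Lemma relax_ge mu N V p s t : s <= t ->
  (forall u : R, s <= u <= t -> is_derive u 1 V (- mu * V u + p u)) ->
  (forall u, s <= u <= t -> - (mu * N) <= p u) ->
  (V s + N) * expR (mu * s) <= (V t + N) * expR (mu * t).
Proof.
move=> st dV pN.
have := @relax_le mu N (fun u => - V u) (fun u => - p u) s t st.
rewrite -!opprD !mulNr lerN2; apply => u ust; last by rewrite lerNl pN.
by have h := is_deriveN1 (dV u ust); apply: is_derive_eq; ring.
Qed.

Lemma relax_bound mu N V p s t : s <= t ->
  (forall u : R, s <= u <= t -> is_derive u 1 V (- mu * V u + p u)) ->
  (forall u, s <= u <= t -> `|p u| <= mu * N) ->
  `|V s| <= N -> `|V t| <= N.
Proof.
move=> st dV pN; rewrite !ler_norml => /andP[Vs1 Vs2]; apply/andP; split.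
  have : 0 <= (V t + N) * expR (mu * t).
    apply: le_trans (relax_ge st dV _).
      by rewrite pmulr_lge0 ?expR_gt0//; lra.
    by move=> u /pN; rewrite ler_norml => /andP[].
  by rewrite pmulr_lge0 ?expR_gt0//; lra.
have : (V t - N) * expR (mu * t) <= 0.
  apply: le_trans (relax_le st dV _) _.
    by move=> u /pN; rewrite ler_norml => /andP[].
  by rewrite pmulr_lle0 ?expR_gt0//; lra.
by rewrite pmulr_lle0 ?expR_gt0//; lra.
Qed.

(** An excess of [V] over [N] at time [t] would have been exponentially larger at earlier times,
    against the bound [B]. The value of [B] does not enter the conclusion. *)
Lemma relax_global_le mu N B V p : 0 < mu ->
  (forall t : R, is_derive t 1 V (- mu * V t + p t)) ->
  (forall t, p t <= mu * N) -> (forall t, V t <= B) ->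
  forall t, V t <= N.
Proof.
move=> mu0 dV pN VB t; rewrite leNgt; apply/negP => NV.
set d := V t - N; have d0 : 0 < d by rewrite subr_gt0.
have dB : d <= B - N by rewrite lerB.
(* Going back by [x], the excess is at least [d * (1 + mu * x) = d + (B - N)], which exceeds the
   [B - N] that the bound allows. *)
set x := (B - N) / (d * mu).
have x0 : 0 <= x by rewrite divr_ge0 ?mulr_ge0// ?ltW// (lt_le_trans d0).
have st : t - x <= t by rewrite gerBl.
have h := relax_le st (fun u _ => dV u) (fun u _ => pN u).
have : d * expR (mu * x) <= B - N.
  have -> : mu * x = mu * t - mu * (t - x) by ring.
  rewrite expRB mulrA ler_pdivrMr ?expR_gt0//; apply: (le_trans h).
  by rewrite ler_pM2r ?expR_gt0// lerB.
have : d * (1 + mu * x) <= d * expR (mu * x).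
  by rewrite ler_pM2l// expR_ge1Dx.
have -> : d * (1 + mu * x) = d + (B - N) by rewrite /x; field; rewrite !gt_eqF.
lra.
Qed.

Lemma relax_global mu N B V p : 0 < mu ->
  (forall t : R, is_derive t 1 V (- mu * V t + p t)) ->
  (forall t, `|p t| <= mu * N) -> (forall t, `|V t| <= B) ->
  forall t, `|V t| <= N.
Proof.
move=> mu0 dV pN VB t; rewrite ler_norml; apply/andP; split.
  rewrite lerNl; apply: (@relax_global_le mu N B (fun t => - V t)
      (fun t => - p t)) => // {}t.
  - by have h := is_deriveN1 (dV t); apply: is_derive_eq; ring.
  - by apply: le_trans (pN t); rewrite -normrN ler_norm.
  - by apply: le_trans (VB t); rewrite -normrN ler_norm.
apply: (@relax_global_le mu N B V p) => // {}t.
- exact: le_trans (ler_norm _) (pN t).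
- exact: le_trans (ler_norm _) (VB t).
Qed.

(* [V t = exp(- mu t) * \int_(-oo)^t exp(mu u) p u du]. *)
Lemma exists_bounded_relax mu M p : 0 < mu -> continuous p ->
  (forall t, `|p t| <= mu * M) ->
  exists V, (forall t : R, is_derive t 1 V (- mu * V t + p t)) /\
    forall t, `|V t| <= M.
Proof.
move=> mu0 cp pM.
have dexp (t : R) := is_derive_expRM mu t.
have [|P dP] := @exists_antiderivative R (fun u => expR (mu * u) * p u).
  by move=> t; apply: cvgM; [exact: is_derive_continuous (dexp t)|exact: cp].
have up s t : s <= t ->
    P s + M * expR (mu * s) <= P t + M * expR (mu * t).
  move=> st; apply: (@ge0_is_derive_le _ (fun u => P u + M * expR (mu * u))
    (fun u => expR (mu * u) * p u + M * (mu * expR (mu * u)))) => // u _.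
  have /[!ler_norml] /andP[h _] := pM u.
  have -> : expR (mu * u) * p u + M * (mu * expR (mu * u)) =
    expR (mu * u) * (p u + mu * M) by ring.
  by rewrite pmulr_rge0 ?expR_gt0//; lra.
have down s t : s <= t ->
    P t - M * expR (mu * t) <= P s - M * expR (mu * s).
  move=> st; apply: (@le0_is_derive_le _ (fun u => P u - M * expR (mu * u))
    (fun u => expR (mu * u) * p u - M * (mu * expR (mu * u)))) => // u _.
  have /[!ler_norml] /andP[_ h] := pM u.
  have -> : expR (mu * u) * p u - M * (mu * expR (mu * u)) =
    expR (mu * u) * (p u - mu * M) by ring.
  by rewrite pmulr_rle0 ?expR_gt0//; lra.
have M0 : 0 <= M by rewrite -(pmulr_rge0 _ mu0); exact: le_trans (pM 0).
have cross s t : P s - M * expR (mu * s) <= P t + M * expR (mu * t).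
  have pos u : 0 <= M * expR (mu * u) by rewrite mulr_ge0// expR_ge0.
  case: (leP s t) => [/up|/ltW/down]; have := pos s; have := pos t; lra.
(* [l] is the limit of [P] at minus infinity; the squeeze [|P t - l| <= M * expR (mu * t)] is
   exactly the bound wanted for the solution. *)
have [l lP] := @exists_between _ _ 0 (fun t => P t - M * expR (mu * t))
  (fun t => P t + M * expR (mu * t)) cross.
exists (fun t => expR (- mu * t) * (P t - l)); split => t.
  have h1 := is_derive_expRM (- mu) t.
  have h2 := is_deriveB1 (dP t) (is_derive_cst1 l t).
  have h3 := is_deriveM1 h1 h2.
  apply: is_derive_eq.
  have E : expR (- mu * t) * expR (mu * t) = 1 by rewrite -expRD mulNr addNr expR0.
  by rewrite subr0 [_ * (_ * p t)]mulrA E; ring.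
rewrite normrM ger0_norm ?expR_ge0// mulNr expRN mulrC.
rewrite ler_pdivrMr ?expR_gt0// ler_norml.
by have := lP t; lra.
Qed.

End Relaxation.

(** * Contractions in the sup norm *)

Section FixedPoint.
Context {R : realType}.
Implicit Types (f g w : R -> R).

Definition bounded_continuous f :=
  continuous f /\ exists M : R, forall t, `|f t| <= M.

Lemma geometric_lt (C th e : R) : 0 <= th -> th < 1 -> 0 < e ->
  exists n : nat, C * th ^+ n < e.
Proof.
move=> th0 th1 e0.
have /cvgr_lt : C * th ^+ n @[n --> \oo] --> C * 0.
  apply: cvgM; first exact: cvg_cst.
  by apply: cvg_expr; rewrite ger0_norm.
rewrite mulr0 => /(_ e e0) [N _ h].
by exists N; apply: h => /=.
Qed.

(** Banach's fixed point theorem for the sup norm, by iteration from 0. The norm appears only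
    through uniform bounds [m], so no normed space of functions has to be built. *)
Lemma bounded_continuous_fixed_point (T : (R -> R) -> (R -> R)) (th : R) :
  0 <= th -> th < 1 ->
  (forall f, bounded_continuous f -> bounded_continuous (T f)) ->
  (forall f g (m : R), bounded_continuous f -> bounded_continuous g ->
    (forall t, `|f t - g t| <= m) -> forall t, `|T f t - T g t| <= th * m) ->
  exists2 w, bounded_continuous w & forall t, T w t = w t.
Proof.
move=> th0 th1 Tbc Tth.
pose w n := iter n T (fun=> 0).
have bcw n : bounded_continuous (w n).
  elim: n => [|n IHn]; last exact: Tbc.
  by split; [exact: cst_continuous | exists 0 => t; rewrite normr0].
have [_ [C wC]] := bcw 1%N.
have dw n t : `|w n.+1 t - w n t| <= C * th ^+ n.
  elim: n t => [t|n IHn t]; first by rewrite expr0 mulr1 subr0.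
  by rewrite exprS mulrCA; exact: (Tth (w n.+1) (w n)).
have th1' : 0 < 1 - th by rewrite subr_gt0.
(* [E n] is the tail of the geometric series from index [n], hence a bound on the distance from
   [w n] to the limit. *)
pose E n := C * th ^+ n / (1 - th).
have ES n : E n = C * th ^+ n + E n.+1.
  by rewrite /E exprS; field; rewrite gt_eqF.
have C0 : 0 <= C by apply: le_trans (wC 0).
have E0 n : 0 <= E n by rewrite divr_ge0 ?mulr_ge0 ?exprn_ge0// ltW.
have wE m n t : (m <= n)%N -> `|w n t - w m t| <= E m - E n.
  elim: n => [|n IHn]; first by rewrite leqn0 => /eqP ->; rewrite !subrr normr0.
  rewrite leq_eqVlt => /predU1P[->|]; first by rewrite !subrr normr0.
  rewrite ltnS => /IHn h; have := dw n t; have := ES n.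
  have -> : w n.+1 t - w m t = (w n.+1 t - w n t) + (w n t - w m t) by ring.
  have := ler_normD (w n.+1 t - w n t) (w n t - w m t); lra.
have /choice[W hW] : forall t : R, exists x : R, forall n, `|w n t - x| <= E n.
  move=> t.
  have [|x hx] := @exists_between _ _ 0%N (fun n => w n t - E n)
      (fun n => w n t + E n).
    move=> m n; have := E0 m; have := E0 n.
    by case: (leqP m n) => [mn|/ltnW mn]; have := wE _ _ t mn;
      rewrite ler_norml; lra.
  by exists x => n; have := hx n; rewrite ler_norml; lra.
have Esmall e : 0 < e -> exists n, E n < e.
  move=> e0; have [n hn] := geometric_lt (C / (1 - th)) th0 th1 e0.
  by exists n; rewrite /E mulrAC.
have bcW : bounded_continuous W.
  split; last first.
    by exists (E 0%N) => t; have := hW t 0%N; rewrite /= sub0r normrN.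
  move=> t; apply/cvgrPdist_lt => e e0.
  have [|n hn] := Esmall (e / 3); first by rewrite divr_gt0.
  have /cvgrPdist_lt/(_ (e / 3)) := (bcw n).1 t.
  rewrite divr_gt0// => /(_ isT); apply: filterS => s.
  have := hW t n; have := hW s n; rewrite !ler_norml !ltr_norml; lra.
exists W => // t; apply: contrapT => /eqP; rewrite -subr_eq0 -normr_gt0 => e0.
(* Both [T W t] and [W t] lie within [E n] of [w n.+1 t], so their distance is at most [2 * E n]. *)
have [|n hn] := Esmall (`|T W t - W t| / 2); first by rewrite divr_gt0.
have hT := Tth _ _ _ bcW (bcw n) _ t.
have {hT} : `|T W t - w n.+1 t| <= th * E n.
  by apply: hT => s; rewrite distrC.
have : th * E n <= E n by rewrite ler_piMl// ltW.
have : E n.+1 <= E n.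
  by rewrite (ES n) lerDr mulr_ge0// exprn_ge0.
have := hW t n.+1; have := ler_distD (w n.+1 t) (T W t) (W t); lra.
Qed.

End FixedPoint.

(** * Damped second-order systems *)

Section DampedSystem.
Context {R : realType}.
Variables (mu1 mu2 : R).
Hypotheses (mu1_gt0 : 0 < mu1) (mu2_gt0 : 0 < mu2).
Implicit Types (D V e p w : R -> R) (k eta N B t : R).

(** The bounds by [B] only make the supremum [S] of [|D|] finite. Two successive relaxations give
    [S <= (k * S + eta) / (mu1 * mu2)], which can be solved for [S] because [k < mu1 * mu2]. *)
Lemma damped_global_bound k eta B D V e : 0 <= k -> k < mu1 * mu2 ->
  (forall t : R, is_derive t 1 D (- mu2 * D t + V t)) ->
  (forall t : R, is_derive t 1 V (- mu1 * V t + e t)) ->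
  (forall t, `|e t| <= k * `|D t| + eta) ->
  (forall t, `|D t| <= B) -> (forall t, `|V t| <= B) ->
  forall t, `|D t| <= eta / (mu1 * mu2 - k) /\
            `|V t| <= mu2 * (eta / (mu1 * mu2 - k)).
Proof.
move=> k0 ka dD dV eD DB VB.
have a0 : 0 < mu1 * mu2 by rewrite mulr_gt0.
have bound N : (forall t, `|D t| <= N) ->
    forall t, `|V t| <= mu2 * ((k * N + eta) / (mu1 * mu2)).
  move=> DN; apply: (relax_global mu1_gt0 dV _ VB) => t.
  have -> : mu1 * (mu2 * ((k * N + eta) / (mu1 * mu2))) = k * N + eta.
    by field; rewrite !gt_eqF.
  by apply: le_trans (eD t) _; rewrite lerD2r ler_wpM2l.
have hS : has_sup (range (fun t => `|D t|)).
  by split; [exists `|D 0|, 0 | exists B => _ [t _ <-]].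
set S := sup (range (fun t => `|D t|)).
have DS t : `|D t| <= S by apply: (sup_upper_bound hS); exists t.
have DN t : `|D t| <= (k * S + eta) / (mu1 * mu2).
  exact: (relax_global mu2_gt0 dD (bound _ DS) DB).
have : S <= (k * S + eta) / (mu1 * mu2).
  by apply: ge_sup; [exact: hS.1 | move=> _ [t _ <-]].
rewrite ler_pdivlMr// => Sle.
have SN : S <= eta / (mu1 * mu2 - k).
  by rewrite ler_pdivlMr ?subr_gt0//; lra.
have {}DN t : `|D t| <= eta / (mu1 * mu2 - k) := le_trans (DS t) SN.
move=> t; split=> //; have := bound _ DN t.
suff -> : (k * (eta / (mu1 * mu2 - k)) + eta) / (mu1 * mu2) =
  eta / (mu1 * mu2 - k) by [].
by field; rewrite !gt_eqF// subr_gt0.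
Qed.

(** Continuation argument: [e] is controlled only while [|D| <= B], but as long as this lasts the
    relaxation estimates give [|D| <= N < B], so the last such time cannot be finite. *)
Lemma damped_trap N B D V e : N < B ->
  (forall t : R, 0 <= t -> is_derive t 1 D (- mu2 * D t + V t)) ->
  (forall t : R, 0 <= t -> is_derive t 1 V (- mu1 * V t + e t)) ->
  (forall t, 0 <= t -> `|D t| <= B -> `|e t| <= mu1 * (mu2 * N)) ->
  `|D 0| <= N -> `|V 0| <= mu2 * N ->
  forall t, 0 <= t -> `|D t| <= N /\ `|V t| <= mu2 * N.
Proof.
move=> NB dD dV eN D0 V0.
pose S := [set t : R | 0 <= t /\ forall u : R, 0 <= u <= t -> `|D u| <= B].
have SN t : S t -> `|D t| <= N /\ `|V t| <= mu2 * N.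
  move=> [t0 tB].
  have VN u : 0 <= u <= t -> `|V u| <= mu2 * N.
    move=> /andP[u0 ut]; apply: (relax_bound u0 _ _ V0) => v /andP[v0 vu].
      exact: dV.
    by apply: eN => //; apply: tB; rewrite v0 (le_trans vu).
  split; last by apply: VN; rewrite t0 lexx.
  apply: (relax_bound t0 _ _ D0) => v /andP[v0 vt]; first exact: dD.
  by apply: VN; rewrite v0.
suff all t : 0 <= t -> S t by move=> t /all /SN.
move=> t0; apply: contrapT => nSt.
have S0 : S 0.
  split=> // u; rewrite -eq_le => /eqP <-.
  by rewrite (le_trans D0)// ltW.
have Sdown (u v : R) : 0 <= u -> u <= v -> S v -> S u.
  move=> u0 uv [v0 vB]; split=> // x /andP[x0 xu]; apply: vB.
  by rewrite x0 (le_trans xu).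
have hS : has_sup S.
  split; first by exists 0.
  exists t => u Su; rewrite leNgt; apply/negP => tu.
  by apply: nSt; apply: Sdown Su => //; exact: ltW.
set s := sup S.
have s0 : 0 <= s by exact: (sup_upper_bound hS).
have NB2 : 0 < (B - N) / 2 by rewrite divr_gt0// subr_gt0.
(* Two half-margins [(B - N) / 2] lead from a time [u] just before [s], where [|D u| <= N], to the
   times up to [s + r / 2]. *)
have /cvgrPdist_lt/(_ _ NB2) [r /= r0 hr] := is_derive_continuous (dD s s0).
have [u Su] := sup_adherent r0 hS; rewrite -/s => su.
have us : u <= s by exact: (sup_upper_bound hS).
have [DuN _] := SN u Su.
have : S (s + r / 2).
  split=> [|v /andP[v0 vs]]; first by rewrite addr_ge0// divr_ge0// ltW.
  case: (leP v u) => vu; first by apply: Su.2; rewrite v0.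
  have hu : `|D s - D u| < (B - N) / 2.
    by apply: hr; rewrite /ball/= ltr_norml; lra.
  have hv : `|D s - D v| < (B - N) / 2.
    by apply: hr; rewrite /ball/= ltr_norml; lra.
  move: hu hv DuN; rewrite !ltr_norml !ler_norml; lra.
move=> /(sup_upper_bound hS); rewrite -/s; lra.
Qed.

(** The Lyapunov function is [Phi = mu1 * mu2 * D ^+ 2 + V ^+ 2]. Half its derivative is [- Q] plus
    cross terms bounded by [(mu1 * mu2 + k) * |D| * |V|], and the arithmetic-geometric inequality
    bounds these by [th * Q] with [th < 1]. *)
Lemma damped_decay k D V e : 0 <= k -> k < mu1 * mu2 ->
  (forall t : R, 0 <= t -> is_derive t 1 D (- mu2 * D t + V t)) ->
  (forall t : R, 0 <= t -> is_derive t 1 V (- mu1 * V t + e t)) ->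
  (forall t, 0 <= t -> `|e t| <= k * `|D t|) ->
  exists C gamma : R, 0 < gamma /\ forall t, 0 <= t ->
    (mu1 * mu2 * D t ^+ 2 + V t ^+ 2) * expR (gamma * t) <= C.
Proof.
move=> k0 ka dD dV eD.
have a0 : 0 < mu1 * mu2 by rewrite mulr_gt0.
pose th := (mu1 * mu2 + k) / (2 * (mu1 * mu2)).
have th1 : th < 1 by rewrite /th ltr_pdivrMr ?mulr_gt0//; lra.
have th0 : 0 <= th by rewrite /th divr_ge0//; lra.
(* Since [m * Phi <= Q], the remaining dissipation [2 * (1 - th) * Q] dominates [gamma * Phi]. *)
pose m := Num.min mu1 mu2; pose gamma : R := 2 * (1 - th) * m.
have m0 : 0 < m by rewrite lt_min mu1_gt0.
pose Phi t := mu1 * mu2 * (D t * D t) + V t * V t.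
exists (Phi 0), gamma; split; first by rewrite !mulr_gt0// subr_gt0.
move=> t t0.
pose dPhi (u : R) : R := 2 * (mu1 * mu2 * D u * (- mu2 * D u + V u) +
  V u * (- mu1 * V u + e u)).
have -> : mu1 * mu2 * D t ^+ 2 + V t ^+ 2 = Phi t by rewrite /Phi; ring.
have -> : Phi 0 = Phi 0 * expR (gamma * 0) by rewrite mulr0 expR0 mulr1.
apply: (@le0_is_derive_le _ (fun u => Phi u * expR (gamma * u))
  (fun u => (dPhi u + gamma * Phi u) * expR (gamma * u)) _ _ t0) => u /andP[u0 _].
  have h1 := is_deriveZ1 (mu1 * mu2) (is_deriveM1 (dD u u0) (dD u u0)).
  have h2 := is_deriveM1 (dV u u0) (dV u u0).
  have h3 := is_deriveM1 (is_deriveD1 h1 h2) (is_derive_expRM gamma u).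
  by apply: is_derive_eq; rewrite /dPhi /Phi; ring.
rewrite pmulr_lle0 ?expR_gt0//.
have eV : e u * V u <= k * (`|D u| * `|V u|).
  apply: (le_trans (ler_norm _)); rewrite normrM mulrA.
  by rewrite ler_wpM2r// eD.
have DV : D u * V u <= `|D u| * `|V u| by rewrite -normrM ler_norm.
have DD : D u * D u = `|D u| * `|D u| by rewrite -normrM ger0_norm// -expr2 sqr_ge0.
have VV : V u * V u = `|V u| * `|V u| by rewrite -normrM ger0_norm// -expr2 sqr_ge0.
pose Q := mu1 * mu2 * mu2 * (`|D u| * `|D u|) + mu1 * (`|V u| * `|V u|).
have AG : (mu1 * mu2 + k) * (`|D u| * `|V u|) <= th * Q.
  have -> : (mu1 * mu2 + k) * (`|D u| * `|V u|) =
    th * (2 * (mu1 * mu2) * (`|D u| * `|V u|)).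
    by rewrite /th; field; rewrite !gt_eqF.
  rewrite ler_wpM2l// -subr_ge0.
  have -> : Q - 2 * (mu1 * mu2) * (`|D u| * `|V u|) =
    mu1 * (mu2 * `|D u| - `|V u|) ^+ 2 by rewrite /Q; ring.
  by rewrite mulr_ge0 ?sqr_ge0// ltW.
have mQ : m * Phi u <= Q.
  rewrite /Phi /Q mulrDr -DD -VV lerD//.
    rewrite mulrCA !mulrA -!mulrA ler_wpM2l ?(ltW mu1_gt0)//.
    rewrite ler_wpM2l ?(ltW mu2_gt0)// ler_wpM2r ?ge_min ?lexx ?orbT//.
    by rewrite -expr2 sqr_ge0.
  by rewrite ler_wpM2r ?ge_min ?lexx// -expr2 sqr_ge0.
have {}mQ : (1 - th) * (m * Phi u) <= (1 - th) * Q.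
  by rewrite ler_wpM2l// subr_ge0 ltW.
have aDV : mu1 * mu2 * (D u * V u) <= mu1 * mu2 * (`|D u| * `|V u|).
  by rewrite ler_wpM2l// ltW.
have -> : dPhi u + gamma * Phi u = 2 * (mu1 * mu2 * (D u * V u) + e u * V u - Q
    + (1 - th) * (m * Phi u)).
  by rewrite /dPhi /gamma /Phi /Q -DD -VV; ring.
rewrite pmulr_rle0//; lra.
Qed.

Lemma damped_attraction k D V e : 0 <= k -> k < mu1 * mu2 ->
  (forall t : R, 0 <= t -> is_derive t 1 D (- mu2 * D t + V t)) ->
  (forall t : R, 0 <= t -> is_derive t 1 V (- mu1 * V t + e t)) ->
  (forall t, 0 <= t -> `|e t| <= k * `|D t|) ->
  D t @[t --> +oo] --> (0 : R) /\ V t @[t --> +oo] --> (0 : R).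
Proof.
move=> k0 ka dD dV eD.
have a0 : 0 < mu1 * mu2 by rewrite mulr_gt0.
have [C [gam [gam0 hC]]] := damped_decay k0 ka dD dV eD.
have C0 : 0 <= C.
  apply: le_trans (hC 0 (lexx _)).
  by rewrite mulr_ge0 ?expR_ge0// addr_ge0 ?sqr_ge0// mulr_ge0 ?sqr_ge0// ltW.
suff small (c : R) (X : R -> R) : 0 < c ->
    (forall t, 0 <= t -> c * X t ^+ 2 * expR (gam * t) <= C) ->
    X t @[t --> +oo] --> (0 : R).
  split.
    apply: (small _ D a0) => t /hC; apply: le_trans.
    by rewrite ler_wpM2r ?expR_ge0// lerDl sqr_ge0.
  apply: (small 1 V) => // t /hC; apply: le_trans.
  by rewrite ler_wpM2r ?expR_ge0// mul1r lerDr mulr_ge0 ?sqr_ge0// ltW.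
move=> c0 cX; apply/cvgrPdist_lt => eps eps0.
near=> t; rewrite sub0r normrN.
have t0 : 0 < t by near: t; exact: nbhs_pinfty_gt.
(* From this time on, [eps <= |X t|] is impossible: already [expR (gam * t) >= gam * t] would push
   the left side of [cX] above [C]. *)
have tbig : C / (c * eps ^+ 2 * gam) < t.
  by near: t; apply: nbhs_pinfty_gt; rewrite num_real.
rewrite -(ltr_pXn2r (n := 2)) ?nnegrE ?normr_ge0 ?(ltW eps0)// real_normK ?num_real//.
rewrite ltNge; apply/negP => h.
have := cX t (ltW t0); apply/negP; rewrite -ltNge.
move: tbig; rewrite ltr_pdivrMr ?mulr_gt0 ?exprn_gt0// => tbig.
apply: (lt_le_trans tbig).
have -> : t * (c * eps ^+ 2 * gam) = (c * eps ^+ 2) * (gam * t) by ring.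
apply: ler_pM.
- by rewrite mulr_ge0 ?sqr_ge0// ltW.
- by rewrite mulr_ge0// ltW.
- by rewrite ler_wpM2l// ltW.
- by apply: le_trans (expR_ge1Dx _); rewrite lerDr.
Unshelve. all: by end_near. Qed.

End DampedSystem.

(** * Existence for damped systems, on the whole line and from initial data *)

Section DampedExistence.
Context {R : realType}.
Implicit Types (mu N m k eta : R) (V p w J : R -> R).

Lemma bounded_continuousB (f g : R -> R) : bounded_continuous f ->
  bounded_continuous g -> bounded_continuous (fun t => f t - g t).
Proof.
move=> [cf [M fM]] [cg [N gN]]; split; last first.
  exists (M + N) => t; apply: (le_trans (ler_normB _ _)).
  exact: lerD (fM t) (gN t).
by move=> t; apply: cvgB; [exact: cf | exact: cg].
Qed.

Lemma relax_solution_operator mu : 0 < mu -> exists K : (R -> R) -> R -> R,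
  forall p, bounded_continuous p -> bounded_continuous (K p) /\
    forall t : R, is_derive t 1 (K p) (- mu * K p t + p t).
Proof.
move=> mu0.
have /choice[K hK] : forall p, exists V, bounded_continuous p ->
    bounded_continuous V /\
    forall t : R, is_derive t 1 V (- mu * V t + p t).
  move=> p; have [[cp [M pM]]|nbcp] := pselect (bounded_continuous p); last first.
    (* Default value on inputs that are not bounded and continuous, so that [K] is total. *)
    by exists (fun=> 0).
  have [|V [dV VM]] := exists_bounded_relax mu0 cp (M := M / mu).
    by move=> t; rewrite mulrC divfK ?gt_eqF.
  exists V => _; split=> //; split; last by exists (M / mu).
  by move=> t; exact: is_derive_continuous (dV t).
by exists K.
Qed.

(** Lipschitz constant [1 / mu] in the sup norm, as for a bounded inverse of [D + mu]; the bound on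
    the inputs is scaled by [mu] to avoid a division. *)
Definition sup_contracting mu (J : (R -> R) -> R -> R) :=
  (forall p, bounded_continuous p -> bounded_continuous (J p)) /\
  (forall p q m, bounded_continuous p -> bounded_continuous q ->
    (forall t, `|p t - q t| <= mu * m) -> forall t, `|J p t - J q t| <= m).

(** The composite map has Lipschitz constant [k / (mu1 * mu2) < 1]. Abstract [J1] and [J2] let the
    same argument serve for bounded solutions and for initial value problems. *)
Lemma damped_fixed_point mu1 mu2 k (J1 J2 : (R -> R) -> R -> R)
    (q : R -> R -> R) : 0 < mu1 -> 0 < mu2 -> 0 <= k -> k < mu1 * mu2 ->
  sup_contracting mu1 J1 -> sup_contracting mu2 J2 ->
  (forall w, bounded_continuous w -> bounded_continuous (fun t => q t (w t))) ->
  (forall t x y, `|q t x - q t y| <= k * `|x - y|) ->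
  exists w, bounded_continuous w /\ w = J2 (J1 (fun t => q t (w t))).
Proof.
move=> mu1_gt0 mu2_gt0 k0 ka [J1bc J1c] [J2bc J2c] qbc qk.
have a0 : 0 < mu1 * mu2 by rewrite mulr_gt0.
have [||p pbc|p r m pbc rbc prm|w wbc hw] := @bounded_continuous_fixed_point R
    (fun w => J2 (J1 (fun t => q t (w t)))) (k / (mu1 * mu2)).
- by rewrite divr_ge0// ltW.
- by rewrite ltr_pdivrMr// mul1r.
- exact/J2bc/J1bc/qbc.
- apply: J2c; [exact/J1bc/qbc | exact/J1bc/qbc |].
  apply: J1c; [exact: qbc | exact: qbc | move=> t].
  have -> : mu1 * (mu2 * (k / (mu1 * mu2) * m)) = k * m.
    by field; rewrite !gt_eqF.
  by apply: le_trans (qk _ _ _) _; rewrite ler_wpM2l.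
by exists w; split=> //; apply/funext => t; rewrite hw.
Qed.

Lemma damped_bounded_solution mu1 mu2 k (q : R -> R -> R) :
  0 < mu1 -> 0 < mu2 -> 0 <= k -> k < mu1 * mu2 ->
  (forall w, bounded_continuous w -> bounded_continuous (fun t => q t (w t))) ->
  (forall t x y, `|q t x - q t y| <= k * `|x - y|) ->
  exists w V, [/\ bounded_continuous w, bounded_continuous V,
    forall t : R, is_derive t 1 w (- mu2 * w t + V t) &
    forall t : R, is_derive t 1 V (- mu1 * V t + q t (w t))].
Proof.
move=> mu1_gt0 mu2_gt0 k0 ka qbc qk.
(* The difference of two bounded solutions is a bounded solution for the difference of the inputs,
   to which [relax_global] applies. *)
have contr mu (K : (R -> R) -> R -> R) : 0 < mu ->
    (forall p, bounded_continuous p -> bounded_continuous (K p) /\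
      forall t : R, is_derive t 1 (K p) (- mu * K p t + p t)) ->
    sup_contracting mu K.
  move=> mu0 hK; split=> [p /hK[]//|p r m pbc rbc prm].
  have [pK dp] := hK p pbc; have [rK dr] := hK r rbc.
  have [_ [B KB]] := bounded_continuousB pK rK.
  apply: (@relax_global _ mu m B (fun t => K p t - K r t)
    (fun t => p t - r t)) => // t.
  by have h := is_deriveB1 (dp t) (dr t); apply: is_derive_eq; ring.
have [K1 hK1] := relax_solution_operator mu1_gt0.
have [K2 hK2] := relax_solution_operator mu2_gt0.
have [w [wbc hw]] := damped_fixed_point mu1_gt0 mu2_gt0 k0 ka
  (contr _ _ mu1_gt0 hK1) (contr _ _ mu2_gt0 hK2) qbc qk.
have [Vbc dV] := hK1 _ (qbc _ wbc).
have [_ dw] := hK2 _ Vbc; rewrite -hw in dw.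
by exists w, (K1 (fun t => q t (w t))).
Qed.

Lemma bounded_continuous_clamp (f : R -> R) d : continuous f ->
  (exists M : R, forall t, - d <= t -> `|f t| <= M) ->
  bounded_continuous (fun t => f (Num.max t (- d))).
Proof.
move=> cf [M fM]; split; last first.
  by exists M => t; apply: fM; rewrite le_max lexx orbT.
move=> t; apply: continuous_comp; last exact: cf.
apply: continuous_max; first exact: cvg_id.
exact: cst_continuous.
Qed.

(* The initial value problem is solved by a contraction in the sup norm of
   [`[- d, +oo[]; times before [- d] are clamped to [- d]. The contraction
   constant does not see the backward part provided [exp(- mu d) >= 1/2]. *)
Lemma ivp_operator mu d v0 : 0 < mu -> 0 <= d -> mu * d <= 1 / 2 ->
  exists J : (R -> R) -> R -> R, sup_contracting mu J /\
    forall p, bounded_continuous p -> J p 0 = v0 /\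
      forall t : R, - d < t -> is_derive t 1 (J p) (- mu * J p t + p t).
Proof.
move=> mu0 d0 mud.
have [K hK] := relax_solution_operator mu0.
(* The homogeneous solution corrects the value at 0. It is unbounded backward in time, hence the
   clamping of times. *)
pose L p t := K p t + (v0 - K p 0) * expR (- mu * t).
have dL p (t : R) : bounded_continuous p ->
    is_derive t 1 (L p) (- mu * L p t + p t).
  move=> /hK[_ dK].
  have h := is_deriveD1 (dK t) (is_deriveZ1 (v0 - K p 0) (is_derive_expRM (- mu) t)).
  by apply: is_derive_eq; rewrite /L; ring.
have cL p : bounded_continuous p -> continuous (L p).
  by move=> pbc t; exact: is_derive_continuous (dL p t pbc).
have L0 p : L p 0 = v0 by rewrite /L mulr0 expR0; ring.
exists (fun p t => L p (Num.max t (- d))); split; first split.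
- move=> p pbc; apply: bounded_continuous_clamp; first exact: cL.
  have [[_ [M KM]] _] := hK p pbc.
  exists (M + `|v0 - K p 0| * expR (mu * d)) => t dt.
  apply: (le_trans (ler_normD _ _)); apply: lerD; first exact: KM.
  rewrite normrM ler_wpM2l// ger0_norm ?expR_ge0// ler_expR mulNr -mulrN.
  by rewrite ler_pM2l// lerNl.
- move=> p r m pbc rbc prm t.
  suff H s : - d <= s -> `|L p s - L r s| <= m.
    by apply: H; rewrite le_max lexx orbT.
  move=> ds.
  pose D u := L p u - L r u.
  have dD (u : R) : is_derive u 1 D (- mu * D u + (p u - r u)).
    have h := is_deriveB1 (dL p u pbc) (dL r u rbc).
    by apply: is_derive_eq; rewrite /D; ring.
  have D0 : D 0 = 0 by rewrite /D !L0 subrr.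
  have m0 : 0 <= m by rewrite -(pmulr_rge0 _ mu0); exact: le_trans (prm 0).
  case: (leP 0 s) => s0.
    apply: (@relax_bound _ mu m D _ 0 s s0 (fun u _ => dD u)) => //.
    by rewrite D0 normr0.
  (* Backward from 0, [h1] and [h2] say that [D s - m >= - m / E] and [D s + m <= m / E] for
     [E = expR (mu * s)]; as [1 / E <= 2], both give [|D s| <= m]. *)
  have e2 : 1 / 2 <= expR (mu * s).
    apply: le_trans (expR_ge1Dx _).
    have : mu * (- d) <= mu * s by rewrite ler_pM2l.
    lra.
  have h1 := @relax_le _ mu m D _ s 0 (ltW s0) (fun u _ => dD u)
    (fun u _ => le_trans (ler_norm _) (prm u)).
  have h2 : (D s + m) * expR (mu * s) <= (D 0 + m) * expR (mu * 0).
    apply: (@relax_ge _ mu m D _ s 0 (ltW s0) (fun u _ => dD u)) => u _.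
    by have := prm u; rewrite ler_norml => /andP[].
  move: h1 h2; rewrite D0 mulr0 expR0 mulr1 sub0r add0r mulr1 => h1 h2.
  rewrite -[L p s - L r s]/(D s) ler_norml; apply/andP; split.
    rewrite leNgt; apply/negP => Dm.
    have : (D s - m) * expR (mu * s) <= (D s - m) * (1 / 2).
      by rewrite ler_wnM2l//; lra.
    lra.
  rewrite leNgt; apply/negP => Dm.
  have : (D s + m) * (1 / 2) <= (D s + m) * expR (mu * s).
    by rewrite ler_wpM2l//; lra.
  lra.
move=> p pbc; split=> [|t dt]; first by rewrite max_l ?L0// oppr_le0.
rewrite (max_l (ltW dt)); apply: near_eq_is_derive (dL p t pbc).
by near=> s; rewrite max_l// ltW//; near: s; exact: lt_nbhsr.
Unshelve. all: by end_near. Qed.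

Lemma damped_ivp mu1 mu2 k (q : R -> R -> R) (w0 v0 : R) :
  0 < mu1 -> 0 < mu2 -> 0 <= k -> k < mu1 * mu2 ->
  (forall w, bounded_continuous w -> bounded_continuous (fun t => q t (w t))) ->
  (forall t x y, `|q t x - q t y| <= k * `|x - y|) ->
  exists (d : R) w V, [/\ 0 < d, w 0 = w0, V 0 = v0,
    forall t : R, - d < t -> is_derive t 1 w (- mu2 * w t + V t) &
    forall t : R, - d < t -> is_derive t 1 V (- mu1 * V t + q t (w t))].
Proof.
move=> mu1_gt0 mu2_gt0 k0 ka qbc qk.
(* One [d] for both factors: [mu1 * d] and [mu2 * d] are positive with sum [1 / 2]. *)
pose d := (2 * (mu1 + mu2))^-1.
have m12 : 0 < mu1 + mu2 by rewrite addr_gt0.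
have d0 : 0 < d by rewrite invr_gt0 mulr_gt0.
have dE : (mu1 + mu2) * d = 1 / 2 by rewrite /d; field; rewrite gt_eqF.
have p1 : 0 < mu1 * d by rewrite mulr_gt0.
have p2 : 0 < mu2 * d by rewrite mulr_gt0.
have [|J1 [J1c hJ1]] := ivp_operator v0 mu1_gt0 (ltW d0); first lra.
have [|J2 [J2c hJ2]] := ivp_operator w0 mu2_gt0 (ltW d0); first lra.
have [w [wbc hw]] := damped_fixed_point mu1_gt0 mu2_gt0 k0 ka J1c J2c qbc qk.
have qw := qbc _ wbc.
have [V0 dV] := hJ1 _ qw.
have [w_0 dw] := hJ2 _ (J1c.1 _ qw); rewrite -hw in w_0 dw.
by exists d, w, (J1 (fun t => q t (w t))).
Qed.

End DampedExistence.

(** * Trigonometric polynomials on the torus *)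

Section TrigonometricPolynomials.
Context {R : realType}.

Lemma is_derive_sum_seq (I : Type) (s : seq I) (P : pred I) (F : I -> R -> R)
    (dF : I -> R) (x : R) :
  (forall i, P i -> is_derive x 1 (F i) (dF i)) ->
  is_derive x 1 (fun t => \sum_(i <- s | P i) F i t) (\sum_(i <- s | P i) dF i).
Proof.
move=> dFi; elim: s => [|i s IHs].
  rewrite big_nil (_ : (fun t => _) = fun=> 0); first exact: is_derive_cst1.
  by apply/funext => t; rewrite big_nil.
rewrite big_cons (_ : (fun t => _) = fun t =>
  (if P i then F i t + \sum_(j <- s | P j) F j t
   else \sum_(j <- s | P j) F j t)); last first.
  by apply/funext => t; rewrite big_cons.
by case: ifPn => // /dFi Pi; exact: is_deriveD1.
Qed.

Lemma periodicz (f : R -> R) (T : R) : periodic f T ->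
  forall (n : int) a, f (a + n%:~R * T) = f a.
Proof.
move=> fT n a; have fTn := periodicn fT.
case: (intP n) => [|m|m]; first by rewrite mul0r addr0.
  by rewrite mulr_natl fTn.
by rewrite mulrNz mulNr -[in RHS](subrK (m.+1%:R * T) a) mulr_natl fTn.
Qed.

Lemma le_dist_is_derive (f df : R -> R) (x y : R) :
  (forall t : R, is_derive t 1 f (df t)) -> (forall t, `|df t| <= 1) ->
  `|f x - f y| <= `|x - y|.
Proof.
move=> dfE df1; wlog yx : x y / y <= x.
  move=> h; case: (leP y x) => [|/ltW] /h //.
  by rewrite distrC (distrC x).
have dB (u : R) : is_derive u 1 (fun t => f t - t) (df u - 1).
  exact: is_deriveB1.
have dD (u : R) : is_derive u 1 (fun t => f t + t) (df u + 1).
  exact: is_deriveD1.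
rewrite [`|x - y|]ger0_norm ?subr_ge0// ler_norml.
have := @le0_is_derive_le _ _ _ _ _ yx (fun u _ => dB u).
have := @ge0_is_derive_le _ _ _ _ _ yx (fun u _ => dD u).
move=> h1 h2; have := h1 _; have := h2 _.
have h u : -1 <= df u <= 1 by rewrite -ler_norml.
move=> {}h2 {}h1.
have : f x - x <= f y - y by apply: h2 => u _; have := h u; lra.
have : f y + y <= f x + x by apply: h1 => u _; have := h u; lra.
lra.
Qed.

Lemma le_dist_cos (x y : R) : `|cos x - cos y| <= `|x - y|.
Proof.
apply: (@le_dist_is_derive _ (fun t => - sin t)) => t.
by rewrite normrN sin_max.
Qed.

Lemma le_dist_sin (x y : R) : `|sin x - sin y| <= `|x - y|.
Proof. by apply: (@le_dist_is_derive _ cos) => t; exact: cos_max. Qed.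

Variable d : nat.
Implicit Types (nu : 'rV[int]_d) (psi phi omega : 'rV[R]_d)
  (s : seq 'rV[int]_d) (a b : 'rV[int]_d -> R).

Lemma int_dotD nu psi phi :
  int_dot nu (psi + phi) = int_dot nu psi + int_dot nu phi.
Proof.
by rewrite /int_dot -big_split; apply: eq_bigr => i _; rewrite mxE mulrDr.
Qed.

Lemma int_dotZ nu c psi : int_dot nu (c *: psi) = c * int_dot nu psi.
Proof.
by rewrite /int_dot mulr_sumr; apply: eq_bigr => i _; rewrite mxE mulrCA.
Qed.

Lemma int_dot0 psi : int_dot 0 psi = 0.
Proof. by rewrite /int_dot big1// => i _; rewrite mxE mul0r. Qed.

Lemma int_dot_delta nu i : int_dot nu (delta_mx 0 i) = (nu 0 i)%:~R :> R.
Proof.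
rewrite /int_dot (bigD1 i)//= mxE !eqxx mulr1 big1 ?addr0// => j ji.
by rewrite mxE (negbTE ji) andbF mulr0.
Qed.

Lemma continuous_int_dot nu : continuous (@int_dot R d nu).
Proof.
apply: continuous_big => [|i _ psi]; first exact: add_continuous.
have h := @coord_continuous R 1 d 0 i psi.
apply: continuous_comp h _; exact: mulrl_continuous.
Qed.

Definition trig s a b psi : R := \sum_(nu <- s)
  (a nu * cos (int_dot nu psi) + b nu * sin (int_dot nu psi)).

Lemma trig_bounded s a b : exists M : R, forall psi, `|trig s a b psi| <= M.
Proof.
exists (\sum_(nu <- s) (`|a nu| + `|b nu|)) => psi.
apply: (le_trans (ler_norm_sum _ _ _)); apply: ler_sum => nu _.
apply: (le_trans (ler_normD _ _)); rewrite !normrM.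
by apply: lerD; apply: ler_piMr; rewrite ?normr_ge0 ?cos_max ?sin_max.
Qed.

(** The bound involves the phases only through differences of [int_dot], which are unchanged when
    both phases move by the same [t *: omega]. This is the source of continuity uniform in time. *)
Lemma trig_dist s a b psi phi : `|trig s a b psi - trig s a b phi| <=
  \sum_(nu <- s) (`|a nu| + `|b nu|) * `|int_dot nu psi - int_dot nu phi|.
Proof.
rewrite /trig -sumrB.
apply: (le_trans (ler_norm_sum _ _ _)); apply: ler_sum => nu _.
rewrite opprD addrACA -!mulrBr.
apply: (le_trans (ler_normD _ _)); rewrite !normrM mulrDl.
by apply: lerD; rewrite ler_wpM2l// ?le_dist_cos ?le_dist_sin.
Qed.

Lemma trig_torus s a b : torus_fun (trig s a b).
Proof.
move=> i psi; apply: eq_bigr => nu _.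
rewrite int_dotD int_dotZ int_dot_delta [pi *+ 2 * _]mulrC.
by rewrite (periodicz (@cosD2pi R)) (periodicz (@sinD2pi R)).
Qed.

Lemma is_derive_trig s a b omega psi (t : R) :
  is_derive t 1 (fun t => trig s a b (psi + t *: omega))
   (trig s (fun nu => b nu * int_dot nu omega)
     (fun nu => - a nu * int_dot nu omega) (psi + t *: omega)).
Proof.
apply: (@is_derive_sum_seq _ s xpredT (fun nu t =>
  a nu * cos (int_dot nu (psi + t *: omega)) +
  b nu * sin (int_dot nu (psi + t *: omega)))) => nu _.
have E : (fun t : R => int_dot nu (psi + t *: omega)) =
    fun t => int_dot nu psi + int_dot nu omega * t.
  by apply/funext => u; rewrite int_dotD int_dotZ mulrC.
have hd : is_derive t 1 (fun t : R => int_dot nu (psi + t *: omega))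
    (0 + int_dot nu omega * 1).
  by rewrite E; apply: is_deriveD1.
have hc := @is_derive1_comp _ cos _ _ _ _ (is_derive_cos _) hd.
have hs := @is_derive1_comp _ sin _ _ _ _ (is_derive_sin _) hd.
have h := is_deriveD1 (is_deriveZ1 (a nu) hc) (is_deriveZ1 (b nu) hs).
apply: is_derive_eq; ring.
Qed.

End TrigonometricPolynomials.

(** * Averages of trigonometric polynomials *)

Section TorusAverage.
Context {R : realType}.
Notation mu := (@lebesgue_measure R).

Lemma Rintegral_is_derive (f F : R -> R) (a b : R) : a < b -> continuous f ->
  (forall t : R, is_derive t 1 F (f t)) ->
  \int[mu]_(x in `[a, b]) f x = F b - F a.
Proof.
move=> ab cf dF; rewrite /Rintegral.
have cF : continuous F by move=> t; exact: is_derive_continuous (dF t).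
rewrite (@continuous_FTC2 _ f F a b ab) ?EFinB//.
- exact: continuous_subspaceT.
- split; first by move=> t _; exact: ex_derive.
    exact: cvg_at_right_filter (cF a).
  exact: cvg_at_left_filter (cF b).
- by move=> t _; rewrite derive1E; exact: derive_val.
Qed.

Lemma integral_trig1 (I : Type) (s : seq I) (P : pred I) (n : I -> int)
    (a b phi : I -> R) :
  \int[mu]_(u in `[0, pi *+ 2]) (\sum_(i <- s | P i)
    (a i * cos ((n i)%:~R * u + phi i) + b i * sin ((n i)%:~R * u + phi i))) =
  pi *+ 2 * \sum_(i <- s | P i && (n i == 0))
    (a i * cos (phi i) + b i * sin (phi i)).
Proof.
have pi2 : 0 < pi *+ 2 :> R by rewrite pmulrn_lgt0// pi_gt0.
(* Termwise antiderivative: linear at frequency zero, otherwise [2 pi]-periodic and so without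
   contribution over a period. *)
pose F i (u : R) := if n i == 0 then (a i * cos (phi i) + b i * sin (phi i)) * u
  else (n i)%:~R^-1 * (a i * sin ((n i)%:~R * u + phi i)
                      - b i * cos ((n i)%:~R * u + phi i)).
have dlin i (u : R) : is_derive u 1 (fun u => (n i)%:~R * u + phi i)
    ((n i)%:~R * 1 + 0).
  exact: is_deriveD1.
have dc i u := @is_derive1_comp _ cos _ _ _ _ (is_derive_cos _) (dlin i u).
have ds i u := @is_derive1_comp _ sin _ _ _ _ (is_derive_sin _) (dlin i u).
have dF i (u : R) : is_derive u 1 (F i)
    (a i * cos ((n i)%:~R * u + phi i) + b i * sin ((n i)%:~R * u + phi i)).
  rewrite /F; case: eqP => [->|/eqP ni0].
    rewrite mul0r add0r -[X in is_derive _ _ _ X]mulr1; exact: is_deriveZ1.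
  have ni0' : (n i)%:~R != 0 :> R by rewrite intr_eq0.
  have h := is_deriveZ1 (n i)%:~R^-1
    (is_deriveB1 (is_deriveZ1 (a i) (ds i u)) (is_deriveZ1 (b i) (dc i u))).
  by apply: is_derive_eq; field.
have dS (u : R) : is_derive u 1 (fun u => \sum_(i <- s | P i) F i u)
    (\sum_(i <- s | P i) (a i * cos ((n i)%:~R * u + phi i) +
      b i * sin ((n i)%:~R * u + phi i))).
  by apply: is_derive_sum_seq => i _; exact: dF.
rewrite (Rintegral_is_derive pi2 _ dS).
  rewrite -sumrB mulr_sumr big_mkcondr/=; apply: eq_bigr => i _.
  rewrite /F; case: eqP => [_|_]; first by rewrite mulr0 subr0 mulrC.
  rewrite mulr0 add0r [_ + phi i]addrC (periodicz (@cosD2pi R)).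
  by rewrite (periodicz (@sinD2pi R)) subrr.
apply: continuous_big => [|i _ u]; first exact: add_continuous.
have hc := is_derive_continuous (is_deriveZ1 (a i) (dc i u)).
have hs := is_derive_continuous (is_deriveZ1 (b i) (ds i u)).
exact: cvgD hc hs.
Qed.

(** Induction on the dimension: for a fixed first coordinate its contribution is absorbed into the
    phases [phi]. Terms are indexed by [I] and not by frequency, because deleting a coordinate may
    identify distinct frequencies. *)
Lemma torus_integral_trig d (I : Type) (s : seq I) (nu : I -> 'rV[int]_d)
    (a b phi : I -> R) :
  torus_integral (fun psi => \sum_(i <- s)
    (a i * cos (int_dot (nu i) psi + phi i) +
     b i * sin (int_dot (nu i) psi + phi i))) =
  (pi *+ 2) ^+ d * \sum_(i <- s | nu i == 0)
    (a i * cos (phi i) + b i * sin (phi i)).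
Proof.
elim: d nu phi => [|d IHd] nu phi /=.
  rewrite expr0 mul1r [RHS]big_mkcond; apply: eq_bigr => i _.
  by rewrite /int_dot !big_ord0 !add0r ifT//; apply/eqP; exact: thinmx0.
have nuE i : (nu i == 0) = (rsubmx (nu i : 'rV_(1 + d)) == 0) && (nu i 0 0 == 0).
  apply/eqP/andP => [->|[/eqP r0 /eqP n0]].
    by rewrite mxE eqxx; split=> //; apply/eqP/matrixP => k l; rewrite !mxE.
  apply/rowP => j; rewrite [in RHS]mxE.
  case: (split_ordP (j : 'I_(1 + d))) => k ->.
    by rewrite (ord1 k) -n0; congr (nu i 0 _); exact: val_inj.
  by have := congr1 (fun M : 'rV_d => M 0 k) r0; rewrite !mxE.
have dotE i (u : R) (v : 'rV[R]_d) :
    int_dot (nu i) (row_mx (const_mx u : 'rV[R]_1) v : 'rV[R]_d.+1) + phi i =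
    int_dot (rsubmx (nu i : 'rV_(1 + d))) v + ((nu i 0 0)%:~R * u + phi i).
  rewrite /int_dot big_ord_recl addrA [_ + _%:~R * u]addrC; congr (_ + _ + _).
    have E : row_mx (const_mx u : 'rV[R]_1) v 0 (lshift d 0) = u.
      by rewrite row_mxEl mxE.
    by rewrite -[in RHS]E; congr (_ * row_mx _ _ 0 _); exact: val_inj.
  apply: eq_bigr => j _; rewrite [rsubmx _ _ _]mxE.
  have E : row_mx (const_mx u : 'rV[R]_1) v 0 (rshift 1 j) = v 0 j.
    by rewrite row_mxEr.
  rewrite (_ : lift ord0 j = rshift 1 j :> 'I_d.+1); last exact: val_inj.
  by congr (_ * _); exact: E.
under eq_Rintegral => u _.
  under [X in torus_integral X]eq_fun do under eq_bigr do rewrite dotE.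
  rewrite IHd mulr_sumr.
  under eq_bigr do rewrite mulrDr !mulrA.
  over.
rewrite integral_trig1 exprS -mulrA; congr (_ * _).
rewrite mulr_sumr; apply: eq_big => i; first by rewrite nuE.
by move=> _; rewrite mulrDr !mulrA.
Qed.

(** The list [s] may repeat frequencies, so [a 0] is counted once for each occurrence of 0. *)
Lemma torus_average_trig d (s : seq 'rV[int]_d) (a b : 'rV[int]_d -> R) :
  torus_average (trig s a b) = \sum_(nu <- s | nu == 0) a 0.
Proof.
have pi2 : pi *+ 2 != 0 :> R by rewrite mulrn_eq0/= gt_eqF// pi_gt0.
have := @torus_integral_trig d _ s id a b (fun=> 0).
under [X in torus_integral X]eq_fun do under eq_bigr do rewrite !addr0.
rewrite /torus_average => ->; rewrite mulrAC divff ?expf_neq0// mul1r.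
by apply: eq_bigr => nu /eqP ->; rewrite cos0 sin0 mulr1 mulr0 addr0.
Qed.

Lemma trig_split_average d (s : seq 'rV[int]_d) (a b : 'rV[int]_d -> R) psi :
  trig s a b psi =
  torus_average (trig s a b) + trig [seq nu <- s | nu != 0] a b psi.
Proof.
rewrite torus_average_trig /trig big_filter (bigID (fun nu => nu == 0))/=.
congr (_ + _); apply: eq_bigr => nu /eqP ->.
by rewrite int_dot0 cos0 sin0 mulr1 mulr0 addr0.
Qed.

End TorusAverage.

(** * Power series *)

Section AnalyticRemainder.
Context {R : realType}.

Lemma le_dist_exprn (x y s : R) n : `|x| <= s -> `|y| <= s ->
  `|x ^+ n.+1 - y ^+ n.+1| <= `|x - y| * (n.+1%:R * s ^+ n).
Proof.
move=> xs ys; have s0 : 0 <= s by exact: le_trans xs.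
rewrite subrXX normrM ler_wpM2l//.
apply: (le_trans (ler_norm_sum _ _ _)).
rewrite -[n.+1 in leRHS]card_ord mulr_natl -sumr_const; apply: ler_sum => i _.
have -> : s ^+ n = s ^+ (n.+1.-1 - i) * s ^+ i by rewrite -exprD subnK// -ltnS.
by rewrite normrM !normrX ler_pM ?exprn_ge0// lerXn2r ?nnegrE.
Qed.

(** Beyond the linear term, the term of degree [n] has Lipschitz constant [n * |c n| * s ^ (n - 1)]
    on [[- s, s]]. As [|c n| * t ^ n] is bounded, these constants are dominated by a geometric
    series proportional to [s]. *)
Lemma pseries_remainder (c : R^nat) (G : R -> R) (r k : R) : 0 < r -> 0 < k ->
  (forall y, `|y| < r -> pseries c y @ \oo --> G y) ->
  exists2 s : R, 0 < s & forall y z : R, `|y| <= s -> `|z| <= s ->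
    `|(G y - c 1%N * y) - (G z - c 1%N * z)| <= k * `|y - z|.
Proof.
move=> r0 k0 cG.
pose t := r / 2.
have t0 : 0 < t by rewrite divr_gt0.
have tr : t < r by rewrite /t; lra.
have [M [M0 hM]] : exists M : R, 0 < M /\ forall n, `|c n * t ^+ n| <= M.
  have cvt : cvgn (pseries c t).
    by apply: (cvgP (G t)); apply: cG; rewrite gtr0_norm.
  have [M [_ hM]] := cvg_series_bounded cvt.
  exists (Num.max 1 (M + 1)); split=> [|n]; first by rewrite lt_max ltr01.
  have := hM (M + 1); rewrite ltrDl ltr01 => /(_ isT n I) h.
  by rewrite (le_trans h)// le_max lexx orbT.
(* The bound [1 / 4] beats the factor [n.+2 <= 2 ^ n.+1] and leaves the ratio [1 / 2]; the second
   bound brings the sum below [k]. *)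
pose q := Num.min (1 / 4) (k * t / (8 * M)).
have q0 : 0 < q by rewrite lt_min divr_gt0//= divr_gt0 ?mulr_gt0.
have q4 : q <= 1 / 4 by rewrite ge_min lexx.
have qk : 4 * (M / t) * q <= k.
  apply: (@le_trans _ _ (4 * (M / t) * (k * t / (8 * M)))).
    by rewrite ler_wpM2l ?ge_min ?lexx ?orbT// mulr_ge0// divr_ge0// ltW.
  have -> : 4 * (M / t) * (k * t / (8 * M)) = k / 2 by field; rewrite !gt_eqF.
  lra.
have s0 : 0 < q * t by rewrite mulr_gt0.
exists (q * t) => // y z ys zs.
have st : q * t < r by apply: le_lt_trans tr; rewrite ger_pMl//; lra.
pose T n := `|(pseries c y n - c 1%N * y) - (pseries c z n - c 1%N * z)|.
have cT : T n @[n --> \oo] --> `|(G y - c 1%N * y) - (G z - c 1%N * z)|.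
  apply: cvg_norm; apply: cvgB; apply: cvgB; try exact: cvg_cst.
    by apply: cG; exact: le_lt_trans st.
  by apply: cG; exact: le_lt_trans st.
have term n : `|c n.+2 * y ^+ n.+2 - c n.+2 * z ^+ n.+2| <=
    `|y - z| * (2 * (M / t) * q) * (1 / 2) ^+ n.
  rewrite -mulrBr normrM.
  apply: (@le_trans _ _ (`|c n.+2| * (`|y - z| * (n.+2%:R * (q * t) ^+ n.+1)))).
    by rewrite ler_wpM2l// le_dist_exprn.
  have -> : `|c n.+2| * (`|y - z| * (n.+2%:R * (q * t) ^+ n.+1)) =
      `|y - z| * ((`|c n.+2 * t ^+ n.+2| / t) * (n.+2%:R * q ^+ n.+1)).
    rewrite normrM [`|t ^+ _|]ger0_norm ?exprn_ge0 ?(ltW t0)// exprMn [t ^+ n.+2]exprS.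
    by field; rewrite gt_eqF.
  rewrite -[leRHS]mulrA ler_wpM2l//.
  have -> : 2 * (M / t) * q * (1 / 2) ^+ n = (M / t) * (2 ^+ n.+1 * (q * (1 / 4) ^+ n)).
    have -> : (1 / 2 : R) ^+ n = 2 ^+ n * (1 / 4) ^+ n.
      by rewrite -exprMn; congr (_ ^+ n); field.
    by rewrite exprS; ring.
  apply: ler_pM.
  - by rewrite divr_ge0// ltW.
  - by rewrite mulr_ge0// exprn_ge0// ltW.
  - by rewrite ler_pM2r ?invr_gt0.
  rewrite exprS; apply: ler_pM => //.
  - by rewrite mulr_ge0 ?exprn_ge0// ltW.
  - by rewrite -natrX ler_nat ltn_expl.
  - by rewrite ler_pM2l// lerXn2r ?nnegrE ?divr_ge0 ?(ltW q0).
have TK n : T n.+2 <= k * `|y - z|.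
  rewrite /T.
  have -> : pseries c y n.+2 - c 1%N * y - (pseries c z n.+2 - c 1%N * z) =
      \sum_(0 <= i < n) (c i.+2 * y ^+ i.+2 - c i.+2 * z ^+ i.+2).
    rewrite /pseries /series/= !big_nat_recl// sumrB !expr0 !expr1; ring.
  apply: (le_trans (ler_norm_sum _ _ _)).
  apply: (@le_trans _ _ (\sum_(0 <= i < n)
      `|y - z| * (2 * (M / t) * q) * (1 / 2) ^+ i)).
    by apply: ler_sum => i _; exact: term.
  rewrite -mulr_sumr.
  have geo : \sum_(0 <= i < n) (1 / 2 : R) ^+ i <= 2.
    have -> : \sum_(0 <= i < n) (1 / 2 : R) ^+ i = series (geometric 1 (1 / 2)) n.
      by apply: eq_bigr => i _; rewrite /geometric [RHS]mul1r.
    have half : `|1 / 2 : R| < 1 by rewrite ger0_norm ?divr_ge0//; lra.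
    have half0 : 0 < 1 / 2 :> R by rewrite divr_gt0.
    apply: (le_trans (geometric_le_lim n ler01 half0 half)).
    by rewrite ler_pdivrMr; lra.
  apply: (@le_trans _ _ (`|y - z| * (2 * (M / t) * q) * 2)).
    rewrite ler_wpM2l// mulr_ge0 ?normr_ge0// mulr_ge0 ?(ltW q0)// mulr_ge0//.
    by rewrite divr_ge0 ?(ltW M0) ?(ltW t0).
  have -> : `|y - z| * (2 * (M / t) * q) * 2 = (4 * (M / t) * q) * `|y - z|.
    by ring.
  by rewrite ler_wpM2r.
rewrite -(cvg_lim _ cT)//; apply: limr_le; first exact: cvgP cT.
near=> n; have n2 : (2 <= n)%N by near: n; exact: nbhs_infty_ge.
by rewrite -(subnK n2) addn2; exact: TK.
Unshelve. all: by end_near. Qed.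

Lemma analytic_remainder (g : R -> R) (x0 k : R) : real_analytic g -> 0 < k ->
  exists2 s : R, 0 < s & forall y z : R, `|y| <= s -> `|z| <= s ->
    `|(g (x0 + y) - g^`()%classic x0 * y) - (g (x0 + z) - g^`()%classic x0 * z)| <=
      k * `|y - z|.
Proof.
move=> ga k0.
have [c [r [r0 cg]]] := ga x0.
have cg' y : `|y| < r -> pseries c y @ \oo --> g (x0 + y).
  by move=> yr; have := cg (x0 + y); rewrite addrAC subrr add0r; exact.
(* The same estimate with [z = 0] and an arbitrary constant [e] says that the difference quotients
   at [x0] tend to [c 1]. *)
suff -> : g^`()%classic x0 = c 1%N by exact: pseries_remainder r0 k0 cg'.
apply/cvg_lim => //; apply/cvgrPdist_le => e e0.
have [s s0 hs] := pseries_remainder r0 e0 cg'.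
near=> h.
have h0 : h != 0 by near: h; exact: nbhs_dnbhs_neq.
have hs' : `|h| <= s by near: h; apply: dnbhs0_le.
have := hs h 0 hs'; rewrite normr0 => /(_ (ltW s0)).
rewrite !addr0 mulr0 !subr0 => H.
have -> : c 1%N - h^-1 *: (g (h + x0) - g x0) =
    - (h^-1 * (g (x0 + h) - c 1%N * h - g x0)).
  by rewrite /GRing.scale/= [h + x0]addrC; field.
rewrite normrN normrM normfV mulrC ler_pdivrMr ?normr_gt0//.
Unshelve. all: by end_near. Qed.

End AnalyticRemainder.

(** * Convex planar sets *)

Section ConvexSimplyConnected.
Context {R : realType}.
Implicit Types (p q : R * R) (A : set (R * R)).

Definition segment_point p q (s : R) : R * R :=
  (p.1 + s * (q.1 - p.1), p.2 + s * (q.2 - p.2)).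

Definition segment_convex A :=
  forall p q (s : R), 0 <= s <= 1 -> A p -> A q -> A (segment_point p q s).

Lemma continuous_segment_point (T : topologicalType) (F : set_system T)
    (FF : Filter F) (f : T -> R * R) (l : T -> R) p q (s : R) :
  f @ F --> p -> l @ F --> s ->
  segment_point (f x) q (l x) @[x --> F] --> segment_point p q s.
Proof.
move=> fp ls.
have f1 : (f x).1 @[x --> F] --> p.1 by apply: cvg_comp fp _; exact: cvg_fst.
have f2 : (f x).2 @[x --> F] --> p.2 by apply: cvg_comp fp _; exact: cvg_snd.
have h1 := cvgD f1 (cvgM ls (cvgB (cvg_cst q.1) f1)).
have h2 := cvgD f2 (cvgM ls (cvgB (cvg_cst q.2) f2)).
exact: (cvg_pair (h1 FF FF FF FF) (h2 FF FF FF FF)).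
Qed.

(** Points are joined by segments, and a loop contracts to its base point along segments. *)
Lemma segment_convex_simply_connected A : A !=set0 -> segment_convex A ->
  simply_connected R A.
Proof.
move=> A0 cA; split => //.
  move=> p q Ap Aq; exists (segment_point p q); split.
  - split; last by move=> _ [s + <-]; rewrite /= in_itv/= => s01; exact: cA.
    apply: continuous_subspaceT => s.
    by apply: (@continuous_segment_point _ (nbhs s) _ (fun=> p) id p q s);
      [exact: cvg_cst | exact: cvg_id].
  - by rewrite /segment_point !mul0r !addr0 -surjective_pairing.
  - by rewrite /segment_point !mul1r ![_ + (_ - _)]addrC !subrK -surjective_pairing.
move=> gam [cgam gamA] gam01.
have gA (t : R) : 0 <= t <= 1 -> A (gam t).
  by move=> t01; apply: gamA; exists t => //=; rewrite in_itv.
exists (fun x => segment_point (gam x.2) (gam 0) x.1); split.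
- apply/subspace_continuousP => -[s t] [/= s01 t01].
  apply: continuous_segment_point; last first.
    by apply: cvg_within_filter; exact: cvg_fst.
  move/subspace_continuousP : cgam => /(_ t t01) cg.
  apply: cvg_comp cg.
  (* [gam] is continuous only within [[0, 1]], so the second projection has to carry neighbourhoods
     within the square to neighbourhoods within [[0, 1]]. *)
  move=> B /=; rewrite /within/= => hB.
  have hB' : \forall x \near (s, t), `[0, 1] x.2 -> B x.2.
    exact: (@cvg_snd _ _ (nbhs s) (nbhs t) _ _ hB).
  by apply: (filterS _ hB') => -[s' t'] /= h [_ t'01]; exact: h.
- move=> _ [[s t] [/= + +] <-]; rewrite !in_itv/= => s01 t01.
  by apply: cA => //; apply: gA => //; rewrite lexx ler01.
- move=> t _; rewrite /segment_point /= !mul0r !addr0 !mul1r.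
  by rewrite ![_ + (_ - _)]addrC !subrK -!surjective_pairing.
- move=> s _; rewrite /segment_point /= -gam01 !subrr !mulr0 !addr0.
  by rewrite -surjective_pairing.
Qed.

End ConvexSimplyConnected.

(** * The oscillator *)

Section SecondOrderEquation.
Context {R : realType}.
Implicit Types (x f g h : R -> R) (I : set R).

Lemma is_derive_derive1 f (t df : R) : is_derive t 1 f df ->
  f^`()%classic t = df.
Proof. by move=> h; rewrite derive1E; exact: derive_val. Qed.

Lemma derivable_is_derive1 f (t : R) : derivable f t 1 ->
  is_derive t 1 f (f^`()%classic t).
Proof. by move=> df; rewrite derive1E; exact: derivableP. Qed.

(** The derivative of [x] is known to be [x1] on [I] only; openness of [I] makes this an identity
    near each [t], so it can be differentiated again. *)
Lemma is_derive_solves eps g h I x x1 x2 : open I ->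
  (forall t : R, I t -> is_derive t 1 x (x1 t)) ->
  (forall t : R, I t -> is_derive t 1 x1 (x2 t)) ->
  (forall t, I t -> eps * x2 t + x1 t + eps * g (x t) = eps * h t) ->
  solves eps g h I x.
Proof.
move=> oI dx dx1 eqx t It.
have x'E s : I s -> x^`()%classic s = x1 s by move=> /dx/is_derive_derive1.
have dx' : is_derive t 1 x^`()%classic (x2 t).
  apply: near_eq_is_derive (dx1 t It).
  have : \near t, I t by exact: open_nbhs_nbhs.
  by apply: filterS => s /x'E.
split.
- by have [] := dx t It.
- by have [] := dx'.
by rewrite [x^`(2)%classic t](is_derive_derive1 dx') x'E// eqx.
Qed.

Lemma solves_is_derive eps g h I x : solves eps g h I x ->
  forall t : R, I t -> is_derive t 1 x (x^`()%classic t) /\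
    is_derive t 1 x^`()%classic (x^`(2)%classic t).
Proof.
move=> sx t /sx [dx dx' _].
by split; [exact: derivable_is_derive1 | exact: (derivable_is_derive1 dx')].
Qed.

Lemma is_derive_shiftl f (s t df : R) : is_derive (s + t) 1 f df ->
  is_derive t 1 (fun u => f (s + u)) df.
Proof.
move=> dfs.
have ds : is_derive t 1 (fun u => s + u) (0 + 1).
  by apply: is_deriveD1; exact: is_derive_cst1.
have h := @is_derive1_comp _ f _ _ _ _ dfs ds.
by apply: is_derive_eq; rewrite add0r mulr1.
Qed.

End SecondOrderEquation.

(** * Truncation of the nonlinear remainder to a globally Lipschitz function *)

Section Truncation.
Context {R : realType}.
Variables (r : R -> R) (rho k : R).
Hypothesis rho_gt0 : 0 < rho.
Hypothesis r_lip : forall y z, `|y| <= rho -> `|z| <= rho ->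
  `|r y - r z| <= k * `|y - z|.

Implicit Types (y z : R).

Definition clamp y : R := Num.max (- rho) (Num.min rho y).

Lemma clampP y : [\/ y <= - rho /\ clamp y = - rho,
  - rho <= y <= rho /\ clamp y = y | rho <= y /\ clamp y = rho].
Proof.
rewrite /clamp; case: (leP rho y) => [ry|/ltW yr].
  by apply: Or33; rewrite max_r//; move: rho_gt0; lra.
case: (leP y (- rho)) => [yr'|/ltW ry]; first exact: Or31.
by apply: Or32; rewrite ry yr.
Qed.

Lemma clamp_le y : `|clamp y| <= rho.
Proof. have := rho_gt0; rewrite ler_norml; case: (clampP y) => -[? ->]; lra. Qed.

Lemma clamp_id y : `|y| <= rho -> clamp y = y.
Proof. have := rho_gt0; rewrite ler_norml; case: (clampP y) => -[? ->]; lra. Qed.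

Lemma clamp_dist y z : `|clamp y - clamp z| <= `|y - z|.
Proof.
wlog yz : y z / y <= z.
  move=> H; case: (leP y z) => [|/ltW] /H //.
  by rewrite distrC [`|z - y|]distrC.
rewrite distrC [`|y - z|]distrC [`|z - y|]ger0_norm ?subr_ge0// ler_norml.
have := rho_gt0; case: (clampP y) => -[? ->]; case: (clampP z) => -[? ->]; lra.
Qed.

Definition truncated y := r (clamp y).

Lemma truncated_id y : `|y| <= rho -> truncated y = r y.
Proof. by move=> ?; rewrite /truncated clamp_id. Qed.

Lemma truncated_lip : 0 <= k -> forall y z,
  `|truncated y - truncated z| <= k * `|y - z|.
Proof.
move=> k0 y z; apply: (le_trans (r_lip (clamp_le y) (clamp_le z))).
by rewrite ler_wpM2l// clamp_dist.
Qed.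

Lemma continuous_truncated : 0 <= k -> continuous truncated.
Proof.
move=> k0 y; apply/cvgrPdist_lt => e e0.
have k1 : 0 < k + 1 by rewrite ltr_wpDl.
apply/nbhs_ballP; exists (e / (k + 1)) => [|z]; rewrite /= ?divr_gt0//.
rewrite /ball/= ltr_pdivlMr// => h; apply: le_lt_trans h.
apply: (le_trans (truncated_lip k0 y z)).
by rewrite mulrC ler_wpM2l// lerDl.
Qed.

End Truncation.

(** * Bounded responses of the truncated system *)

Section ForcedOscillator.
Context {R : realType}.
Variables (eps a mu1 mu2 rho : R) (r : R -> R).
Hypotheses (eps_gt0 : 0 < eps) (mu1_gt0 : 0 < mu1) (mu2_gt0 : 0 < mu2).
Hypotheses (mu12 : mu1 * mu2 = a) (rho_gt0 : 0 < rho) (r0 : r 0 = 0).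
Hypothesis r_lip : forall y z : R, `|y| <= rho -> `|z| <= rho ->
  `|r y - r z| <= a / 2 * `|y - z|.
Implicit Types (h w V : R -> R) (t x y : R).

Let a_gt0 : 0 < a. Proof. by rewrite -mu12 mulr_gt0. Qed.

Let k_ge0 : 0 <= a / 2. Proof. by rewrite divr_ge0// ltW. Qed.

Let k_lt : a / 2 < mu1 * mu2.
Proof. by rewrite mu12 ltr_pdivrMr// mulr_natr mulr2n ltrDl. Qed.

(* The forcing term [q], with the truncated remainder; [h0] and [h2] stand for
   [H0] and its second derivative along [omega]. *)
Definition load h0 h2 (t y : R) : R :=
  - (eps * h2 t) - eps * a * h0 t - truncated r rho (eps * h0 t + y).

Let load0 t : load (fun=> 0) (fun=> 0) t 0 = 0.
Proof.
rewrite /load !mulr0 addr0 truncated_id ?normr0 ?(ltW rho_gt0)// r0.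
by rewrite oppr0 !addr0.
Qed.

Lemma load_lip h0 h2 t x y :
  `|load h0 h2 t x - load h0 h2 t y| <= a / 2 * `|x - y|.
Proof.
have -> : load h0 h2 t x - load h0 h2 t y =
    truncated r rho (eps * h0 t + y) - truncated r rho (eps * h0 t + x).
  by rewrite /load; ring.
apply: (le_trans (truncated_lip rho_gt0 r_lip k_ge0 _ _)).
by rewrite opprD addrACA subrr add0r distrC.
Qed.

(** Of the factor [1 + 3 / 2 * a], [1] comes from [h2], [a] from the linear term in [h0], and
    [a / 2] from [h0] inside the remainder. *)
Lemma load_dist h0 h2 h0' h2' t x y (e : R) : `|h0 t - h0' t| <= e ->
  `|h2 t - h2' t| <= e ->
  `|load h0 h2 t x - load h0' h2' t y| <=
    a / 2 * `|x - y| + eps * (1 + 3 / 2 * a) * e.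
Proof.
move=> he0 he2.
have -> : load h0 h2 t x - load h0' h2' t y =
    - (eps * (h2 t - h2' t)) - eps * a * (h0 t - h0' t) -
    (truncated r rho (eps * h0 t + x) - truncated r rho (eps * h0' t + y)).
  by rewrite /load; ring.
have hT := truncated_lip rho_gt0 r_lip k_ge0 (eps * h0 t + x) (eps * h0' t + y).
have E : eps * h0 t + x - (eps * h0' t + y) = eps * (h0 t - h0' t) + (x - y).
  by ring.
rewrite {}E in hT.
have hS := ler_normD (eps * (h0 t - h0' t)) (x - y).
have {hS} hT := le_trans hT (ler_wpM2l k_ge0 hS).
rewrite normrM (gtr0_norm eps_gt0) in hT.
have h0e : eps * `|h0 t - h0' t| <= eps * e by rewrite ler_pM2l.
have h2e : eps * `|h2 t - h2' t| <= eps * e by rewrite ler_pM2l.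
have ah0e : a * (eps * `|h0 t - h0' t|) <= a * (eps * e) by rewrite ler_pM2l.
apply: (le_trans (ler_normB _ _)).
apply: (le_trans (lerD (ler_normB _ _) (lexx _))).
rewrite normrN !normrM (gtr0_norm eps_gt0) (gtr0_norm a_gt0).
move: hT ah0e h2e; lra.
Qed.

Lemma bounded_continuous_load h0 h2 w : bounded_continuous h0 ->
  bounded_continuous h2 -> bounded_continuous w ->
  bounded_continuous (fun t => load h0 h2 t (w t)).
Proof.
move=> [c0 [B0 hB0]] [c2 [B2 hB2]] [cw [Bw hBw]]; split.
  have cT := continuous_truncated rho_gt0 r_lip k_ge0.
  move=> t.
  have ch0 : eps * h0 u @[u --> t] --> eps * h0 t.
    by apply: cvgM; [exact: cvg_cst | exact: c0].
  have h1 : eps * h0 u + w u @[u --> t] --> eps * h0 t + w t.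
    by apply: cvgD => //; exact: cw.
  have h3 : truncated r rho (eps * h0 u + w u) @[u --> t] -->
      truncated r rho (eps * h0 t + w t).
    by apply: cvg_comp h1 _; exact: cT.
  apply: cvgB h3; apply: cvgB.
    by apply: cvgN; apply: cvgM; [exact: cvg_cst | exact: c2].
  by apply: cvgM; [exact: cvg_cst | exact: c0].
exists (a / 2 * Bw + eps * (1 + 3 / 2 * a) * Num.max B0 B2) => t.
(* Comparison with the zero forcing, whose load vanishes at 0. *)
have := @load_dist h0 h2 (fun=> 0) (fun=> 0) t (w t) 0 (Num.max B0 B2).
rewrite load0 !subr0 !le_max hB0 hB2 orbT => /(_ isT isT) h.
by apply: (le_trans h); rewrite lerD2r ler_wpM2l.
Qed.

Definition bounded_response h0 h2 w V := [/\ bounded_continuous w,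
  bounded_continuous V,
  forall t : R, is_derive t 1 w (- mu2 * w t + V t) &
  forall t : R, is_derive t 1 V (- mu1 * V t + load h0 h2 t (w t))].

Lemma exists_bounded_response h0 h2 : bounded_continuous h0 ->
  bounded_continuous h2 -> exists w V, bounded_response h0 h2 w V.
Proof.
move=> bh0 bh2; have [||w [V [? ? ? ?]]] :=
  damped_bounded_solution mu1_gt0 mu2_gt0 k_ge0 k_lt (q := load h0 h2).
- by move=> w bw; exact: bounded_continuous_load.
- exact: load_lip.
by exists w, V.
Qed.

(** This is [eps * (1 + 3 / 2 * a) / (a - a / 2)], the Lipschitz constant of the map from the
    forcing [(h0, h2)] to the bounded response [w]. *)
Definition response_gain : R := eps * (2 + 3 * a) / a.

(** The difference of two responses is a bounded solution of a damped system with [k = a / 2]. The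
    case [e = 0] is uniqueness; small [e] gives continuity in the phase. *)
Lemma bounded_response_dist h0 h2 w V h0' h2' w' V' (e : R) :
  bounded_response h0 h2 w V -> bounded_response h0' h2' w' V' ->
  (forall t, `|h0 t - h0' t| <= e) -> (forall t, `|h2 t - h2' t| <= e) ->
  forall t, `|w t - w' t| <= response_gain * e /\
            `|V t - V' t| <= mu2 * (response_gain * e).
Proof.
move=> [bw bV dw dV] [bw' bV' dw' dV'] he0 he2 t.
have [_ [B hB]] := bounded_continuousB bw bw'.
have [_ [B' hB']] := bounded_continuousB bV bV'.
have -> : response_gain * e =
    eps * (1 + 3 / 2 * a) * e / (mu1 * mu2 - a / 2).
  by rewrite mu12 /response_gain; field; rewrite gt_eqF//=; move: a_gt0; lra.
apply: (@damped_global_bound _ mu1 mu2 mu1_gt0 mu2_gt0 (a / 2) _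
  (Num.max B B') (fun t => w t - w' t) (fun t => V t - V' t)
  (fun t => load h0 h2 t (w t) - load h0' h2' t (w' t))) => // u.
- have h := is_deriveB1 (dw u) (dw' u).
  by apply: is_derive_eq; ring.
- have h := is_deriveB1 (dV u) (dV' u).
  by apply: is_derive_eq; ring.
- exact: load_dist.
- by rewrite le_max hB.
- by rewrite le_max hB' orbT.
Qed.

Lemma bounded_response_le h0 h2 w V (M : R) : bounded_response h0 h2 w V ->
  (forall t, `|h0 t| <= M) -> (forall t, `|h2 t| <= M) ->
  forall t, `|w t| <= response_gain * M /\
            `|V t| <= mu2 * (response_gain * M).
Proof.
move=> rwV h0M h2M t.
have bc0 : bounded_continuous (fun=> 0 : R).
  by split; [exact: cst_continuous | exists 0 => u; rewrite normr0].
have r00 : bounded_response (fun=> 0) (fun=> 0) (fun=> 0) (fun=> 0).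
  split=> // u; have h := is_derive_cst1 (0 : R) u; apply: is_derive_eq.
    by rewrite mulr0 addr0.
  by rewrite mulr0 add0r load0.
have := @bounded_response_dist _ _ _ _ _ _ _ _ M rwV r00 _ _ t.
by rewrite !subr0; apply => u; rewrite subr0.
Qed.

Lemma load_ivp h0 h2 (w0 V0 : R) : bounded_continuous h0 ->
  bounded_continuous h2 ->
  exists (d : R) w V, [/\ 0 < d, w 0 = w0, V 0 = V0,
    forall t : R, - d < t -> is_derive t 1 w (- mu2 * w t + V t) &
    forall t : R, - d < t ->
      is_derive t 1 V (- mu1 * V t + load h0 h2 t (w t))].
Proof.
move=> bh0 bh2; apply: (damped_ivp w0 V0 mu1_gt0 mu2_gt0 k_ge0 k_lt).
- by move=> w bw; exact: bounded_continuous_load.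
- exact: load_lip.
Qed.

End ForcedOscillator.

(** * Trajectories of the original equation near [c0] *)

Section Trajectories.
Context {R : realType}.
Variables (eps a mu1 mu2 rho M c0 : R) (g h0 h1 h2 F : R -> R).
Hypotheses (eps_gt0 : 0 < eps) (mu1_gt0 : 0 < mu1) (mu2_ge1 : 1 <= mu2).
Hypotheses (mu12 : mu1 * mu2 = a) (epsmu : eps * (mu1 + mu2) = 1).
Hypothesis rho_gt0 : 0 < rho.

Implicit Types (t y : R).

Definition remainder (y : R) : R := g (c0 + y) - g c0 - a * y.

Hypothesis r_lip : forall y z : R, `|y| <= rho -> `|z| <= rho ->
  `|remainder y - remainder z| <= a / 2 * `|y - z|.
Hypothesis dh0 : forall t : R, is_derive t 1 h0 (h1 t).
Hypothesis dh1 : forall t : R, is_derive t 1 h1 (h2 t).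
Hypothesis FE : forall t, F t = g c0 + h1 t.
Hypothesis ch2 : continuous h2.
Hypotheses (h0M : forall t, `|h0 t| <= M) (h1M : forall t, `|h1 t| <= M)
  (h2M : forall t, `|h2 t| <= M).
Hypotheses (small1 : eps * M * (1 + 3 / 2 * a) <= a * rho / 16)
  (small2 : eps * M <= rho / 32).

Let mu2_gt0 : 0 < mu2. Proof. exact: lt_le_trans mu2_ge1. Qed.

Let a_gt0 : 0 < a. Proof. by rewrite -mu12 mulr_gt0. Qed.

Let k_ge0 : 0 <= a / 2. Proof. by rewrite divr_ge0// ltW. Qed.

Let k_lt : a / 2 < mu1 * mu2.
Proof. by rewrite mu12 ltr_pdivrMr// mulr_natr mulr2n ltrDl. Qed.

Let mu1E : mu1 = (1 - eps * mu2) / eps.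
Proof. by rewrite -epsmu; field; rewrite gt_eqF. Qed.

Let remainder0 : remainder 0 = 0.
Proof. by rewrite /remainder addr0 mulr0 !subrr. Qed.

Definition residual (t y : R) : R :=
  - (eps * h2 t) - eps * a * h0 t - remainder (eps * h0 t + y).

Let eh0 t : `|eps * h0 t| <= eps * M.
Proof. by rewrite normrM gtr0_norm// ler_pM2l. Qed.

Let eh1 t : `|eps * h1 t| <= eps * M.
Proof. by rewrite normrM gtr0_norm// ler_pM2l. Qed.

Let eh2 t : `|eps * h2 t| <= eps * M.
Proof. by rewrite normrM gtr0_norm// ler_pM2l. Qed.

Let in_rho t (y : R) : `|y| <= rho / 2 -> `|eps * h0 t + y| <= rho.
Proof.
move=> y2; apply: (le_trans (ler_normD _ _)).
by have := eh0 t; move: small2 rho_gt0; lra.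
Qed.

Lemma residual_load t (y : R) : `|y| <= rho / 2 ->
  load eps a rho remainder h0 h2 t y = residual t y.
Proof. by move=> y2; rewrite /load truncated_id// in_rho. Qed.

(** The part of the remainder due to [y] is at most [a * rho / 4], and [small1] bounds all the rest
    by [a * rho / 16]; the sum is below [3 / 8 * a * rho]. *)
Lemma residual_le t (y : R) : `|y| <= rho / 2 ->
  `|residual t y| <= mu1 * (mu2 * (3 / 8 * rho)).
Proof.
move=> y2; rewrite mulrA mu12.
have rr := r_lip (in_rho t y2) _ (z := 0).
rewrite normr0 (ltW rho_gt0) remainder0 !subr0 in rr; have {}rr := rr isT.
have hS := le_trans rr (ler_wpM2l k_ge0 (ler_normD _ _)).
have ah0 : a * `|eps * h0 t| <= a * (eps * M) by rewrite ler_pM2l.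
have ay : a * `|y| <= a * (rho / 2) by rewrite ler_pM2l.
apply: (le_trans (ler_normB _ _)).
apply: (le_trans (lerD (ler_normB _ _) (lexx _))).
have -> : eps * a * h0 t = a * (eps * h0 t) by ring.
rewrite normrN [`|a * _|]normrM (gtr0_norm a_gt0).
have := mulr_gt0 a_gt0 rho_gt0; have := eh2 t; move: hS ah0 ay small1; lra.
Qed.

Lemma residual_lip t (y z : R) : `|y| <= rho / 2 -> `|z| <= rho / 2 ->
  `|residual t y - residual t z| <= a / 2 * `|y - z|.
Proof.
move=> y2 z2.
have -> : residual t y - residual t z =
    remainder (eps * h0 t + z) - remainder (eps * h0 t + y).
  by rewrite /residual; ring.
apply: (le_trans (r_lip (in_rho t z2) (in_rho t y2))).
by rewrite opprD addrACA subrr add0r distrC.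
Qed.

Definition position (w : R -> R) (t : R) : R := c0 + eps * h0 t + w t.

(** Eliminating [V] gives [w'' + (mu1 + mu2) * w' + mu1 * mu2 * w] on the left; [epsmu] and [mu12]
    turn it into the linear part of the equation divided by [eps]. *)
Lemma system_solves (I : set R) (w V : R -> R) : open I ->
  (forall t : R, I t -> is_derive t 1 w (- mu2 * w t + V t)) ->
  (forall t : R, I t -> is_derive t 1 V (- mu1 * V t + residual t (w t))) ->
  solves eps g F I (position w) /\ forall t, I t ->
    (position w)^`()%classic t = eps * h1 t - mu2 * w t + V t.
Proof.
move=> oI dw dV.
have dx t : I t ->
    is_derive t 1 (position w) (eps * h1 t - mu2 * w t + V t).
  move=> It; have h := is_deriveD1 (is_deriveD1 (is_derive_cst1 c0 t)
    (is_deriveZ1 eps (dh0 t))) (dw t It).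
  by apply: is_derive_eq; ring.
split; last by move=> t /dx/is_derive_derive1.
apply: (is_derive_solves (x2 := fun t => eps * h2 t -
   mu2 * (- mu2 * w t + V t) + (- mu1 * V t + residual t (w t))) oI dx) => t It.
  exact: is_deriveD1 (is_deriveB1 (is_deriveZ1 eps (dh1 t))
    (is_deriveZ1 mu2 (dw t It))) (dV t It).
rewrite FE /residual /remainder /position.
have -> : c0 + (eps * h0 t + w t) = c0 + eps * h0 t + w t by rewrite addrA.
by rewrite -mu12 mu1E; field; rewrite gt_eqF.
Qed.

Definition deviation (x : R -> R) (t : R) : R := x t - c0 - eps * h0 t.

(** The variable [V] of the first-order system, namely [D + mu2] applied to [deviation x]. *)
Definition deviation_velocity (x : R -> R) (t : R) : R :=
  x^`()%classic t - eps * h1 t + mu2 * deviation x t.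

Lemma solves_system (I : set R) x t : solves eps g F I x -> I t ->
  is_derive t 1 (deviation x) (- mu2 * deviation x t + deviation_velocity x t) /\
  is_derive t 1 (deviation_velocity x)
    (- mu1 * deviation_velocity x t + residual t (deviation x t)).
Proof.
move=> sx It; have [dx dx'] := solves_is_derive sx It.
have [_ _ eqx] := sx t It.
have dD : is_derive t 1 (deviation x) (x^`()%classic t - eps * h1 t).
  have h := is_deriveB1 (is_deriveB1 dx (is_derive_cst1 c0 t))
    (is_deriveZ1 eps (dh0 t)).
  by apply: is_derive_eq; ring.
split; first by apply: is_derive_eq; rewrite /deviation_velocity; ring.
have h := is_deriveD1 (is_deriveB1 dx' (is_deriveZ1 eps (dh1 t)))
  (is_deriveZ1 mu2 dD).
apply: is_derive_eq.
have x''E : x^`(2)%classic t =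
    (g c0 + h1 t) - (x^`()%classic t) / eps - g (x t).
  apply: (mulfI (lt0r_neq0 eps_gt0)); rewrite -FE.
  have -> : eps * x^`(2)%classic t =
    eps * F t - x^`()%classic t - eps * g (x t) by rewrite -eqx; ring.
  by field; rewrite gt_eqF.
rewrite x''E /residual /remainder.
have -> : c0 + (eps * h0 t + deviation x t) = x t by rewrite /deviation; ring.
rewrite /deviation_velocity /deviation -mu12 mu1E.
by field; rewrite gt_eqF.
Qed.

(** Up to the terms in [eps * h0] and [eps * h1], this is the rectangle [|w| < rho / 4],
    [|V| < mu2 * (rho / 4)]. The size lies between the bound [rho / 8] for the bounded response and
    the trapping radius [3 / 8 * rho]. *)
Definition basin : set (R * R) :=
  [set p | `|p.1 - c0| < rho / 4 /\ `|p.2 + mu2 * (p.1 - c0)| < mu2 * (rho / 4)].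

(** Since [e] need agree with the residual only where [|w| <= rho / 2], this covers both solutions
    of the truncated system and arbitrary trajectories of the equation. *)
Lemma basin_trapped p (w V e : R -> R) : basin p ->
  (forall t : R, 0 <= t -> is_derive t 1 w (- mu2 * w t + V t)) ->
  (forall t : R, 0 <= t -> is_derive t 1 V (- mu1 * V t + e t)) ->
  (forall t, `|w t| <= rho / 2 -> e t = residual t (w t)) ->
  w 0 = p.1 - c0 - eps * h0 0 ->
  V 0 = p.2 - eps * h1 0 + mu2 * (p.1 - c0 - eps * h0 0) ->
  forall t, 0 <= t -> `|w t| <= rho / 2.
Proof.
move=> [p1 p2] dw dV eE w0 V0 t t0.
have rho0 := rho_gt0.
have mh0 : mu2 * `|eps * h0 0| <= mu2 * (rho / 32).
  by rewrite ler_pM2l// (le_trans (eh0 0)).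
(* The condition [1 <= mu2] lets the term [eps * h1 0], which has no factor [mu2], fit into the
   margin for [V 0]. *)
have mrho : rho <= mu2 * rho by rewrite ler_peMl// ltW.
have [| | | |] := @damped_trap _ mu1 mu2 (3 / 8 * rho) (rho / 2) w V e _ dw dV _ _ _ t t0.
- by lra.
- by move=> u u0 wu; rewrite eE// residual_le.
- rewrite w0; apply: (le_trans (ler_normB _ _)).
  by have := eh0 0; move: p1 small2; lra.
- rewrite V0.
  have -> : p.2 - eps * h1 0 + mu2 * (p.1 - c0 - eps * h0 0) =
      (p.2 + mu2 * (p.1 - c0)) - eps * h1 0 - mu2 * (eps * h0 0) by ring.
  apply: (le_trans (ler_normB _ _)).
  apply: (le_trans (lerD (ler_normB _ _) (lexx _))).
  rewrite [`|mu2 * _|]normrM (gtr0_norm mu2_gt0).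
  by have := eh1 0; move: p2 small2 mh0 mrho; lra.
by move=> wt _; apply: (le_trans wt); lra.
Qed.

(** The truncated initial value problem is solvable, and trapping keeps its solution where the
    truncation is inactive. *)
Lemma exists_trajectory p : basin p -> exists x, trajectory_from eps g F p x.
Proof.
move=> bp.
have bh0 : bounded_continuous h0.
  by split; [move=> t; exact: is_derive_continuous (dh0 t) | exists M].
have bh2 : bounded_continuous h2 by split=> //; exists M.
have [d [w [V [d0 w0 V0 dw dV]]]] := load_ivp eps_gt0 mu1_gt0 mu2_gt0 mu12
  rho_gt0 remainder0 r_lip (p.1 - c0 - eps * h0 0)
  (p.2 - eps * h1 0 + mu2 * (p.1 - c0 - eps * h0 0)) bh0 bh2.
have nd t : 0 <= t -> - d < t by apply: lt_le_trans; rewrite oppr_lt0.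
have wrho : forall t, 0 <= t -> `|w t| <= rho / 2.
  move=> t t0; apply: (@basin_trapped p w V
    (fun t => load eps a rho remainder h0 h2 t (w t))) t0 => //.
  - by move=> u u0; exact: dw (nd u u0).
  - by move=> u u0; exact: dV (nd u u0).
  - by move=> u; exact: residual_load.
(* Trapping concerns [0 <= t] only; on a short interval before 0 the bound follows from continuity
   and the strict inequality at 0. *)
have [e [e0 ed we]] : exists e : R, [/\ 0 < e, e <= d &
    forall t, - e < t -> `|w t| <= rho / 2].
  have w0lt : `|w 0| < rho / 2.
    rewrite w0; apply: (le_lt_trans (ler_normB _ _)).
    by have := eh0 0; case: bp => p1 _; move: p1 small2 rho_gt0; lra.
  have := is_derive_continuous (dw 0 (nd 0 (lexx 0))).
  move=> /cvgrPdist_lt/(_ (rho / 2 - `|w 0|)); rewrite subr_gt0 => /(_ w0lt).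
  move=> /nbhs_ballP[s /= s0 hs]; exists (Num.min d s); split.
  - by rewrite lt_min d0.
  - by rewrite ge_min lexx.
  move=> t et; case: (leP 0 t) => t0; first exact: wrho.
  have ts : `|0 - t| < s.
    rewrite sub0r normrN ltr0_norm// ltrNl; apply: le_lt_trans et.
    by rewrite lerN2 ge_min lexx orbT.
  have := hs t ts; have := ler_normB (w 0) (w 0 - t).
  have := ler_distD (w 0) (w t) 0; rewrite !subr0 distrC => h1' _ h2'.
  by move: h1' h2' => /=; lra.
have inI t : `]- e, +oo[ t -> - e < t by rewrite /= in_itv/= andbT.
have ded t : - e < t -> - d < t by apply: le_lt_trans; rewrite lerN2.
have dwI t : `]- e, +oo[ t -> is_derive t 1 w (- mu2 * w t + V t).
  by move=> /inI/ded/dw.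
have dVI t : `]- e, +oo[ t ->
    is_derive t 1 V (- mu1 * V t + residual t (w t)).
  by move=> /inI et; rewrite -residual_load ?we//; exact/dV/ded.
have oI : open `]- e, +oo[%classic by exact: rray_open.
exists (position w); split.
  exists e => //.
  exact: (system_solves oI dwI dVI).1.
rewrite ((system_solves oI dwI dVI).2 0); last first.
  by rewrite /= in_itv/= andbT oppr_lt0.
by rewrite /position w0 V0 [RHS]surjective_pairing; congr (_, _); ring.
Qed.


(** Both deviations stay within [rho / 2], where the residual is [a / 2]-Lipschitz, so their
    difference is a damped system with [k = a / 2] and decays. *)
Lemma basin_attraction p x (w V : R -> R) : basin p ->
  trajectory_from eps g F p x ->
  (forall t : R, is_derive t 1 w (- mu2 * w t + V t)) ->
  (forall t : R, is_derive t 1 V (- mu1 * V t + residual t (w t))) ->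
  (forall t, `|w t| <= rho / 2) ->
  tends_to x (position w).
Proof.
move=> bp [[d d0 sx] xp] dw dV wrho.
have It (t : R) : 0 <= t -> `]- d, +oo[ t.
  by move=> t0; rewrite /= in_itv/= andbT (lt_le_trans _ t0)// oppr_lt0.
have dD t : 0 <= t -> is_derive t 1 (deviation x)
    (- mu2 * deviation x t + deviation_velocity x t).
  by move=> /It /(solves_system sx)[].
have dDV t : 0 <= t -> is_derive t 1 (deviation_velocity x)
    (- mu1 * deviation_velocity x t + residual t (deviation x t)).
  by move=> /It /(solves_system sx)[].
have xrho : forall t, 0 <= t -> `|deviation x t| <= rho / 2.
  apply: (basin_trapped bp dD dDV) => //; first by rewrite -xp.
  by rewrite -xp.
have [|||cD cV] := @damped_attraction _ mu1 mu2 mu1_gt0 mu2_gt0 (a / 2)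
  (fun t => deviation x t - w t) (fun t => deviation_velocity x t - V t)
  (fun t => residual t (deviation x t) - residual t (w t)) k_ge0 k_lt.
- move=> t t0; have h := is_deriveB1 (dD t t0) (dw t).
  by apply: is_derive_eq; ring.
- move=> t t0; have h := is_deriveB1 (dDV t t0) (dV t).
  by apply: is_derive_eq; ring.
- by move=> t t0; apply: residual_lip => //; exact: xrho.
have [_ x0'] := @system_solves setT w V openT (fun t _ => dw t) (fun t _ => dV t).
rewrite /tends_to.
have -> : (fun t => `|x t - position w t| +
      `|x^`()%classic t - (position w)^`()%classic t|) =
    (fun t => `|deviation x t - w t| +
      `|(deviation_velocity x t - V t) - mu2 * (deviation x t - w t)|).
  apply/funext => t; rewrite (x0' t I).
  have -> : x t - position w t = deviation x t - w t.
    by rewrite /deviation /position; ring.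
  have -> : x^`()%classic t - (eps * h1 t - mu2 * w t + V t) =
      deviation_velocity x t - V t - mu2 * (deviation x t - w t).
    by rewrite /deviation_velocity; ring.
  by [].
have mD : mu2 * (deviation x t - w t) @[t --> +oo] --> mu2 * 0.
  by apply: cvgM => //; exact: cvg_cst.
have := cvgD (cvg_norm cD) (cvg_norm (cvgB cV mD)).
by rewrite mulr0 subr0 normr0 addr0; apply.
Qed.

End Trajectories.

(** * Topology of the basin *)

Section Basin.
Context {R : realType}.
Variables (mu2 rho c0 : R).
Hypotheses (mu2_gt0 : 0 < mu2) (rho_gt0 : 0 < rho).

Lemma open_basin : open (basin mu2 rho c0).
Proof.
have c1 : continuous (fun p : R * R => p.1 - c0).
  by move=> p; apply: cvgB; [exact: cvg_fst | exact: cvg_cst].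
have c2 : continuous (fun p : R * R => p.2 + mu2 * (p.1 - c0)).
  move=> p; apply: cvgD; first exact: cvg_snd.
  by apply: cvgM; [exact: cvg_cst | exact: c1].
have pre (f : R * R -> R) (e : R) : continuous f ->
    open [set p | `|f p| < e].
  move=> cf; rewrite (_ : [set p | _] = (fun p => `|f p|) @^-1` [set x | x < e])//.
  by apply: open_comp; [move=> p _; apply: cvg_norm; exact: cf | exact: open_lt].
exact: openI (pre _ _ c1) (pre _ _ c2).
Qed.

Lemma simply_connected_basin : simply_connected R (basin mu2 rho c0).
Proof.
have r4 : 0 < rho / 4 by rewrite divr_gt0.
have ball_convex (x y s e : R) : 0 <= s <= 1 -> `|x| < e -> `|y| < e ->
    `|x + s * (y - x)| < e.
  move=> /andP[s0 s1] xe ye.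
  have -> : x + s * (y - x) = (1 - s) * x + s * y by ring.
  apply: (le_lt_trans (ler_normD _ _)); rewrite !normrM.
  rewrite (ger0_norm s0) ger0_norm ?subr_ge0//.
  have e0 : 0 < e by exact: le_lt_trans xe.
  case: (eqVneq s 0) => [->|sn0]; first by rewrite subr0 mul1r mul0r addr0.
  have sp : 0 < s by rewrite lt_neqAle eq_sym sn0.
  have h1 : (1 - s) * `|x| <= (1 - s) * e by rewrite ler_wpM2l ?subr_ge0// ltW.
  have h2 : s * `|y| < s * e by rewrite ltr_pM2l.
  lra.
apply: segment_convex_simply_connected.
  exists (c0, 0); split; rewrite /= subrr ?mulr0 ?addr0 normr0//.
  by rewrite mulr_gt0.
move=> p q s s01 [p1 p2] [q1 q2]; split=> /=.
  have -> : p.1 + s * (q.1 - p.1) - c0 =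
    (p.1 - c0) + s * ((q.1 - c0) - (p.1 - c0)) by ring.
  exact: ball_convex.
have -> : p.2 + s * (q.2 - p.2) + mu2 * (p.1 + s * (q.1 - p.1) - c0) =
  (p.2 + mu2 * (p.1 - c0)) +
  s * ((q.2 + mu2 * (q.1 - c0)) - (p.2 + mu2 * (p.1 - c0))) by ring.
exact: ball_convex.
Qed.

End Basin.

(** * Relaxation rates, and continuity and primitives of the forcing *)

(** The rates are the roots of [eps * X ^+ 2 - X + eps * a], real for small [eps]; the larger one is
    at least [1 / (2 * eps)]. *)
Lemma exists_rates {R : realType} (eps a : R) : 0 < eps -> 0 < a ->
  eps <= 1 / 2 -> 4 * a * eps <= 1 -> exists mu1 mu2 : R,
  [/\ 0 < mu1, 1 <= mu2, mu1 * mu2 = a & eps * (mu1 + mu2) = 1].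
Proof.
move=> eps0 a0 eps2 aeps.
have s0 : 0 <= 1 - 4 * a * eps * eps.
  by rewrite subr_ge0 (le_trans (ler_piMr _ _) aeps) ?mulr_ge0 ?ltW//; lra.
pose s : R := Num.sqrt (1 - 4 * a * eps * eps).
have ss : s * s = 1 - 4 * a * eps * eps by rewrite -expr2 sqr_sqrtr.
pose mu1 : R := (1 - s) / (2 * eps); pose mu2 : R := (1 + s) / (2 * eps).
have mu2ge1 : 1 <= mu2.
  rewrite /mu2 ler_pdivlMr ?mulr_gt0// mul1r.
  by have := sqrtr_ge0 (1 - 4 * a * eps * eps); rewrite -/s; lra.
have mu12 : mu1 * mu2 = a.
  have -> : mu1 * mu2 = (1 - s * s) / (4 * eps * eps).
    by rewrite /mu1 /mu2; field; rewrite gt_eqF.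
  by rewrite ss; field; rewrite gt_eqF.
exists mu1, mu2; split=> //.
  by rewrite -(pmulr_lgt0 _ (lt_le_trans ltr01 mu2ge1)) mu12.
by rewrite /mu1 /mu2; field; rewrite gt_eqF.
Qed.

Lemma trig_near {R : realType} d (s : seq 'rV[int]_d) (a b : 'rV[int]_d -> R)
    (omega psi : 'rV[R]_d) (e : R) : 0 < e ->
  \forall phi \near psi, forall t,
    `|trig s a b (psi + t *: omega) - trig s a b (phi + t *: omega)| <= e.
Proof.
move=> e0.
pose D (phi : 'rV[R]_d) : R := \sum_(nu <- s) (`|a nu| + `|b nu|) *
  `|int_dot nu psi - int_dot nu phi|.
have cD : continuous D.
  apply: continuous_big => [|nu _ phi]; first exact: add_continuous.
  have cg : continuous (fun y : R => (`|a nu| + `|b nu|) *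
      `|int_dot nu psi - y|).
    move=> y; apply: cvgM; first exact: cvg_cst.
    by apply: cvg_norm; apply: cvgB; [exact: cvg_cst | exact: cvg_id].
  exact: continuous_comp (@continuous_int_dot _ _ nu phi) (cg _).
have Dpsi : D psi = 0.
  by rewrite /D big1// => nu _; rewrite subrr normr0 mulr0.
have /cvgr_lt := cD psi; rewrite Dpsi => /(_ e e0).
apply: filterS => phi De t; apply: le_trans (ltW De).
apply: (le_trans (trig_dist _ _ _ _ _)); apply: ler_sum => nu _.
by rewrite !int_dotD opprD addrACA subrr addr0.
Qed.

Lemma is_derive_trig_primitive {R : realType} d (s : seq 'rV[int]_d)
    (a b : 'rV[int]_d -> R) (omega psi : 'rV[R]_d) (t : R) :
  (forall nu, nu \in s -> int_dot nu omega != 0) ->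
  is_derive t 1 (fun t => trig s (fun nu => - b nu / int_dot nu omega)
    (fun nu => a nu / int_dot nu omega) (psi + t *: omega))
    (trig s a b (psi + t *: omega)).
Proof.
move=> om0; rewrite (_ : trig s a b _ =
  trig s (fun nu => a nu / int_dot nu omega * int_dot nu omega)
   (fun nu => - (- b nu / int_dot nu omega) * int_dot nu omega)
   (psi + t *: omega)); first exact: is_derive_trig.
apply: eq_big_seq => nu /om0 om; rewrite divfK//.
by rewrite !mulNr opprK divfK.
Qed.

(** * From responses at all phases to one function on the torus *)

Section Hull.
Context {R : realType} (d : nat).
Variables (eps a mu1 mu2 rho : R) (r : R -> R) (omega : 'rV[R]_d).
Implicit Types (psi phi : 'rV[R]_d) (t : R).
Variables (H0 H2 : 'rV[R]_d -> R).
Hypotheses (eps_gt0 : 0 < eps) (mu1_gt0 : 0 < mu1) (mu2_gt0 : 0 < mu2).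
Hypotheses (mu12 : mu1 * mu2 = a) (rho_gt0 : 0 < rho).
Hypothesis r_lip : forall y z : R, `|y| <= rho -> `|z| <= rho ->
  `|r y - r z| <= a / 2 * `|y - z|.
Variables (W V : 'rV[R]_d -> R -> R).
Hypothesis WV : forall psi, bounded_response eps a mu1 mu2 rho r
  (fun t => H0 (psi + t *: omega)) (fun t => H2 (psi + t *: omega))
  (W psi) (V psi).

Let a_gt0 : 0 < a. Proof. by rewrite -mu12 mulr_gt0. Qed.

Let dist := bounded_response_dist eps_gt0 mu1_gt0 mu2_gt0 mu12 rho_gt0 r_lip.

Lemma bounded_response_shift psi (t : R) : bounded_response eps a mu1 mu2 rho r
  (fun u => H0 (psi + t *: omega + u *: omega))
  (fun u => H2 (psi + t *: omega + u *: omega))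
  (fun u => W psi (t + u)) (fun u => V psi (t + u)).
Proof.
have [[cW [B WB]] [cV [C VC]] dW dV] := WV psi.
have ct (u : R) : t + v @[v --> u] --> t + u.
  by apply: cvgD; [exact: cvg_cst | exact: cvg_id].
split.
- split; last by exists B => u; exact: WB.
  by move=> u; apply: cvg_comp (ct u) _; exact: cW.
- split; last by exists C => u; exact: VC.
  by move=> u; apply: cvg_comp (ct u) _; exact: cV.
- by move=> u; exact: is_derive_shiftl (dW (t + u)).
- move=> u; have := is_derive_shiftl (dV (t + u)).
  have E : psi + (t + u) *: omega = psi + t *: omega + u *: omega.
    by rewrite scalerDl addrA.
  by rewrite /load E.
Qed.

Lemma response_eq h0 h2 h0' h2' w v w' v' :
  bounded_response eps a mu1 mu2 rho r h0 h2 w v ->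
  bounded_response eps a mu1 mu2 rho r h0' h2' w' v' ->
  h0 =1 h0' -> h2 =1 h2' -> w =1 w'.
Proof.
move=> wv wv' h00 h22 t; apply/eqP; rewrite -subr_eq0 -normr_le0.
have [||+ _] := dist (e := 0) wv wv' _ _ t.
- by move=> u; rewrite h00 subrr normr0.
- by move=> u; rewrite h22 subrr normr0.
by rewrite mulr0.
Qed.

(** The response at phase [psi], shifted in time by [t], is a response at phase [psi + t *: omega].
    Uniqueness identifies it with the chosen one, although [W] is given separately for each
    phase. *)
Lemma response_hull psi t : W psi t = W (psi + t *: omega) 0.
Proof.
have := response_eq (bounded_response_shift psi t) (WV _)
  (fun u => erefl) (fun u => erefl) 0.
by rewrite addr0.
Qed.

Lemma response_torus : torus_fun H0 -> torus_fun H2 ->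
  torus_fun (fun psi => W psi 0).
Proof.
move=> H0T H2T i psi; apply: response_eq (WV _) (WV _) _ _ 0 => t.
  by rewrite addrAC H0T.
by rewrite addrAC H2T.
Qed.

Hypothesis H0_near : forall psi (e : R), 0 < e -> \forall phi \near psi,
  forall t, `|H0 (psi + t *: omega) - H0 (phi + t *: omega)| <= e.
Hypothesis H2_near : forall psi (e : R), 0 < e -> \forall phi \near psi,
  forall t, `|H2 (psi + t *: omega) - H2 (phi + t *: omega)| <= e.

Lemma continuous_response : continuous (fun psi => W psi 0).
Proof.
move=> psi; apply/(cvgrPdist_le (FF := nbhs_filter psi)) => e e0.
have g0 : 0 < response_gain eps a.
  by rewrite divr_gt0// mulr_gt0// addr_gt0// mulr_gt0.
have eg : 0 < e / response_gain eps a by rewrite divr_gt0.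
apply: filterS2 (H0_near psi eg) (H2_near psi eg) => phi h0 h2.
have [+ _] := dist (WV psi) (WV phi) h0 h2 0.
by rewrite mulrC divfK// gt_eqF.
Qed.

Lemma continuous_forcing_primitive : continuous H0.
Proof.
move=> psi; apply/(cvgrPdist_le (FF := nbhs_filter psi)) => e /(H0_near psi).
by apply: filterS => phi /(_ 0); rewrite scale0r !addr0.
Qed.

End Hull.

Theorem theorem3 (R : realType) (d : nat) (g : R -> R) (f : 'rV[R]_d -> R)
    (g_analytic : real_analytic g)
    (f_torus : torus_fun f)
    (f_trig : trig_polynomial f)
    (c0 : R)
    (g_c0 : g c0 = torus_average f)
    (dg_c0 : 0 < g^`()%classic c0)
    (omega : 'rV[R]_d)
    (omega_nonres : forall nu : 'rV[int]_d, nu != 0 -> int_dot nu omega != 0) :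
  exists2 eps0 : R, 0 < eps0 &
    forall eps : R, 0 < eps -> eps < eps0 ->
      exists x0 : R -> R,
        [/\ solves eps g (fun t => f (t *: omega)) setT x0,
            quasi_periodic omega x0 &
            local_attractor eps g (fun t => f (t *: omega)) x0].
Proof.
have [s [al [be fs]]] := f_trig.
have fE : f = trig s al be by apply/funext => psi; exact: fs.
pose a : R := g^`()%classic c0; rewrite -/a in dg_c0.
have a2 : 0 < a / 2 by rewrite divr_gt0.
have [rho rho0 hrho] := analytic_remainder c0 g_analytic a2.
have r_lip (y z : R) : `|y| <= rho -> `|z| <= rho ->
    `|remainder a c0 g y - remainder a c0 g z| <= a / 2 * `|y - z|.
  move=> yr zr; apply: le_trans (hrho y z yr zr).
  by rewrite le_eqVlt; apply/orP; left; apply/eqP; congr (`|_|);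
    rewrite /remainder /a; ring.
have r0 : remainder a c0 g 0 = 0 by rewrite /remainder addr0 mulr0 !subrr.
pose s' := [seq nu <- s | nu != 0].
have om0 nu : nu \in s' -> int_dot nu omega != 0.
  by rewrite mem_filter => /andP[/omega_nonres].
(* Along [omega], [H0] is a primitive of [H1], the zero-average part of [f], and [H2] is the
   derivative of [H1]. *)
pose H0 := trig s' (fun nu => - be nu / int_dot nu omega)
  (fun nu => al nu / int_dot nu omega).
pose H1 := trig s' al be.
pose H2 := trig s' (fun nu => be nu * int_dot nu omega)
  (fun nu => - al nu * int_dot nu omega).
have fH psi : f psi = g c0 + H1 psi.
  by rewrite g_c0 fE trig_split_average.
have [M0 hM0] : exists M : R, forall psi, `|H0 psi| <= M by exact: trig_bounded.
have [M1 hM1] : exists M : R, forall psi, `|H1 psi| <= M by exact: trig_bounded.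
have [M2 hM2] : exists M : R, forall psi, `|H2 psi| <= M by exact: trig_bounded.
pose M := Num.max 1 (Num.max M0 (Num.max M1 M2)).
have M_gt0 : 0 < M by rewrite lt_max ltr01.
have {}hM0 psi : `|H0 psi| <= M by rewrite !le_max hM0 !orbT.
have {}hM1 psi : `|H1 psi| <= M by rewrite !le_max hM1 !orbT.
have {}hM2 psi : `|H2 psi| <= M by rewrite !le_max hM2 !orbT.
have a32 : 0 < 1 + 3 / 2 * a by lra.
(* The first two thresholds serve [exists_rates]; the last two give [small1] and [small2]. *)
exists (Num.min (Num.min (1 / 2) (1 / (4 * a)))
  (Num.min (a * rho / 16 / (M * (1 + 3 / 2 * a))) (rho / 32 / M))).
  by rewrite !lt_min !divr_gt0 ?mulr_gt0.
move=> eps eps_gt0; rewrite !lt_min => /andP[/andP[e1 e2] /andP[e3 e4]].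
have {}e2 : 4 * a * eps <= 1.
  by move: e2; rewrite ltr_pdivlMr ?mulr_gt0// => /ltW; rewrite mulrC.
have {e3} small1 : eps * M * (1 + 3 / 2 * a) <= a * rho / 16.
  by move: e3; rewrite ltr_pdivlMr ?mulr_gt0// mulrA => /ltW.
have {e4} small2 : eps * M <= rho / 32.
  by move: e4; rewrite ltr_pdivlMr// => /ltW.
have [mu1 [mu2 [mu1_gt0 mu2_ge1 mu12 epsmu]]] :=
  exists_rates eps_gt0 dg_c0 (ltW e1) e2.
have mu2_gt0 : 0 < mu2 := lt_le_trans ltr01 mu2_ge1.
have dH0 (psi : 'rV[R]_d) (t : R) : is_derive t 1 (fun u : R => H0 (psi + u *: omega))
    (H1 (psi + t *: omega)) by exact: is_derive_trig_primitive.
have dH1 (psi : 'rV[R]_d) (t : R) : is_derive t 1 (fun u : R => H1 (psi + u *: omega))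
    (H2 (psi + t *: omega)) by exact: is_derive_trig.
have bH0 (psi : 'rV[R]_d) : bounded_continuous (fun t : R => H0 (psi + t *: omega)).
  by split; [move=> t; exact: is_derive_continuous (dH0 psi t) | exists M].
have cH2 (psi : 'rV[R]_d) : continuous (fun t : R => H2 (psi + t *: omega)).
  by move=> t; exact: is_derive_continuous (is_derive_trig _ _ _ _ _ _).
have bH2 (psi : 'rV[R]_d) : bounded_continuous (fun t : R => H2 (psi + t *: omega)).
  by split; [exact: cH2 | exists M].
have /choice[WV hWV] : forall psi : 'rV[R]_d, exists WV : (R -> R) * (R -> R),
    bounded_response eps a mu1 mu2 rho (remainder a c0 g)
      (fun t : R => H0 (psi + t *: omega)) (fun t : R => H2 (psi + t *: omega))
      WV.1 WV.2.
  move=> psi; have [w [V wV]] := exists_bounded_response eps_gt0 mu1_gt0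
    mu2_gt0 mu12 rho0 r0 r_lip (bH0 psi) (bH2 psi).
  by exists (w, V).
pose W psi := (WV psi).1; pose V psi := (WV psi).2.
have {}hWV (psi : 'rV[R]_d) : bounded_response eps a mu1 mu2 rho (remainder a c0 g)
    (fun t : R => H0 (psi + t *: omega)) (fun t : R => H2 (psi + t *: omega))
    (W psi) (V psi) := hWV psi.
pose h0 (t : R) := H0 (0 + t *: omega); pose h1 (t : R) := H1 (0 + t *: omega).
pose h2 (t : R) := H2 (0 + t *: omega).
(* The left side is [2 / a] times the left side of [small1]. *)
have gainM : response_gain eps a * M <= rho / 8.
  rewrite /response_gain mulrAC ler_pdivrMr//; move: small1; lra.
have Wle (t : R) : `|W 0 t| <= rho / 8 /\ `|V 0 t| <= mu2 * (rho / 8).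
  have [w1 w2] := bounded_response_le eps_gt0 mu1_gt0 mu2_gt0 mu12 rho0 r0 r_lip
    (hWV 0) (fun u => hM0 _) (fun u => hM2 _) t.
  by split; [exact: le_trans gainM | apply: (le_trans w2); rewrite ler_pM2l].
have W2 (t : R) : `|W 0 t| <= rho / 2 by have [w1 _] := Wle t; lra.
have [_ _ dW dV] := hWV 0.
have {}dV (t : R) : is_derive t 1 (V 0)
    (- mu1 * V 0 t + residual eps a c0 g h0 h2 t (W 0 t)).
  rewrite -(residual_load a c0 g h2 eps_gt0 rho0 _ small2 t (W2 t)) => [|u].
    exact: dV.
  exact: hM0.
have FE (t : R) : f (t *: omega) = g c0 + h1 t by rewrite fH /h1 add0r.
have [x0_solves x0'] := system_solves eps_gt0 mu12 epsmu (dH0 0) (dH1 0) FE openT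
  (fun t _ => dW t) (fun t _ => dV t).
exists (position eps c0 h0 (W 0)); split=> //.
  exists (fun psi => c0 + eps * H0 psi + W psi 0); split.
  - move=> i psi.
    have H0T : torus_fun H0 by exact: trig_torus.
    have H2T : torus_fun H2 by exact: trig_torus.
    have WT := response_torus eps_gt0 mu1_gt0 mu2_gt0 mu12 rho0 r_lip hWV H0T H2T.
    by rewrite H0T WT.
  - have H0n psi e := @trig_near R d s' (fun nu => - be nu / int_dot nu omega)
      (fun nu => al nu / int_dot nu omega) omega psi e.
    have H2n psi e := @trig_near R d s' (fun nu => be nu * int_dot nu omega)
      (fun nu => - al nu * int_dot nu omega) omega psi e.
    have cW := continuous_response eps_gt0 mu1_gt0 mu2_gt0 mu12 rho0 r_lip hWV
      H0n H2n.
    have cH0 := continuous_forcing_primitive H0n.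
    move=> psi; have FF := nbhs_filter psi.
    exact: (cvgD (cvgD (cvg_cst c0) (cvgM (cvg_cst eps) (cH0 psi))) (cW psi)).
  - move=> t; rewrite /position /h0 add0r.
    rewrite (response_hull eps_gt0 mu1_gt0 mu2_gt0 mu12 rho0 r_lip hWV).
    by rewrite add0r.
exists (basin mu2 rho c0); split.
- exact: open_basin.
- exact: simply_connected_basin.
(* In each coordinate the response takes [rho / 8] and each forcing term at most [rho / 32] (times
   [mu2] for the second coordinate), which stays below [rho / 4]. *)
- move=> t; rewrite (x0' t I) /position.
  have [w1 w2] := Wle t.
  have eh0 : `|eps * h0 t| <= rho / 32.
    by rewrite normrM gtr0_norm// (le_trans _ small2)// ler_pM2l// hM0.
  have eh1 : `|eps * h1 t| <= rho / 32.
    by rewrite normrM gtr0_norm// (le_trans _ small2)// ler_pM2l// hM1.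
  have mrho : rho <= mu2 * rho by rewrite ler_peMl// ltW.
  split=> /=.
    have -> : c0 + eps * h0 t + W 0 t - c0 = eps * h0 t + W 0 t by ring.
    by apply: (le_lt_trans (ler_normD _ _)); lra.
  have -> : eps * h1 t - mu2 * W 0 t + V 0 t +
      mu2 * (c0 + eps * h0 t + W 0 t - c0) =
    eps * h1 t + mu2 * (eps * h0 t) + V 0 t by ring.
  have mh0 : `|mu2 * (eps * h0 t)| <= mu2 * (rho / 32).
    by rewrite normrM gtr0_norm// ler_pM2l.
  apply: (le_lt_trans (ler_normD _ _)).
  apply: (le_lt_trans (lerD (ler_normD _ _) (lexx _))); lra.
move=> p bp; split.
  exact: (exists_trajectory eps_gt0 mu1_gt0 mu2_ge1 mu12 epsmu rho0 r_lip
    (dH0 0) (dH1 0) FE (cH2 0) (fun u => hM0 _) (fun u => hM1 _)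
    (fun u => hM2 _) small1 small2 bp).
move=> x xp.
exact: (basin_attraction eps_gt0 mu1_gt0 mu2_ge1 mu12 epsmu rho0 r_lip
    (dH0 0) (dH1 0) FE (fun u => hM0 _) (fun u => hM1 _)
    (fun u => hM2 _) small1 small2 bp xp dW dV W2).
Qed.
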